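(* Let $H$ be a compact group and let $\iota_i:H\to G_i$, $i\in I$, be an arbitrary family of split embeddings of compact groups. Then the family $(\iota_i)_{i\in I}$ is algebraically sound.
   Context: Compact groups are compact Hausdorff topological groups, with continuous homomorphisms as morphisms. An embedding of compact groups $\iota:H\to G$ is split if it has a left inverse in the category of compact groups, i.e. a continuous homomorphism $G\to H$ whose composition with $\iota$ is $\mathrm{id}_H$; equivalently, $\iota$ is, up to isomorphism, of the form $H\le K\rtimes H$ for a continuous action of $H$ by automorphisms on a compact group $K$. A family of embeddings $\iota_i:H\to G_i$ of compact groups is algebraically sound if the canonical homomorphism from the free product of the $G_i$ amalgamated over $H$ (the colimit of the $\iota_i$ in the category of abstract groups) to the colimit of the $\iota_i$ in the category of compact groups is injective. *)

(* Defs.v *)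
From HB Require Import structures.
From mathcomp Require Import all_boot.
From mathcomp Require Import all_classical.
From mathcomp Require Import topology.
Set Implicit Arguments.
Unset Strict Implicit.
Unset Printing Implicit Defensive.

Local Open Scope classical_set_scope.
Local Open Scope group_scope.

HB.mixin Record isTopologicalGroup G & Group G & Topological G := {
  mulg_continuous : continuous (fun x : G * G => x.1 * x.2);
  invg_continuous : continuous (fun x : G => x^-1)
}.

#[short(type="topologicalGroupType")]
HB.structure Definition TopologicalGroup :=
  {G of Group G & Topological G & isTopologicalGroup G}.

HB.mixin Record isCompactHausdorff G & Topological G := {
  compact_group_hausdorff : hausdorff_space G;
  compact_group_compact : compact [set: G]
}.

#[short(type="compactGroupType")]
HB.structure Definition CompactGroup :=
  {G of TopologicalGroup G & isCompactHausdorff G}.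

Definition compact_hom (G K : compactGroupType) (f : G -> K) : Prop :=
  monoid_morphism f /\ continuous f.

(* By compactness, an injective continuous homomorphism is automatically a
   homeomorphism onto a closed subgroup. *)
Definition compact_embedding (G K : compactGroupType) (f : G -> K) : Prop :=
  compact_hom f /\ injective f.

Definition split_embedding (H G : compactGroupType) (iota : H -> G) : Prop :=
  compact_embedding iota /\
  exists2 r : G -> H, compact_hom r & cancel iota r.

(* The diagram consists of all the maps [iota i : H -> G i] with common source
   [H]; a cocone carries a leg from [H] itself, so that the empty family is
   treated correctly (its colimit is [H]). *)

Definition group_cocone (I : Type) (H : groupType) (G : I -> groupType)
    (iota : forall i, H -> G i)
    (T : groupType) (h : H -> T) (g : forall i, G i -> T) : Prop :=
  [/\ monoid_morphism h,
      forall i, monoid_morphism (g i) &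
      forall i, g i \o iota i =1 h].

(* Universal property of the free product of the [G i] amalgamated over [H]. *)
Definition group_colimit (I : Type) (H : groupType) (G : I -> groupType)
    (iota : forall i, H -> G i)
    (A : groupType) (a0 : H -> A) (a : forall i, G i -> A) : Prop :=
  group_cocone iota a0 a /\
  forall (T : groupType) (h : H -> T) (g : forall i, G i -> T),
    group_cocone iota h g ->
    exists! f : A -> T,
      [/\ monoid_morphism f, f \o a0 =1 h & forall i, f \o a i =1 g i].

Definition compact_cocone (I : Type) (H : compactGroupType)
    (G : I -> compactGroupType) (iota : forall i, H -> G i)
    (T : compactGroupType) (h : H -> T) (g : forall i, G i -> T) : Prop :=
  [/\ compact_hom h,
      forall i, compact_hom (g i) &
      forall i, g i \o iota i =1 h].

Definition compact_colimit (I : Type) (H : compactGroupType)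
    (G : I -> compactGroupType) (iota : forall i, H -> G i)
    (C : compactGroupType) (c0 : H -> C) (c : forall i, G i -> C) : Prop :=
  compact_cocone iota c0 c /\
  forall (T : compactGroupType) (h : H -> T) (g : forall i, G i -> T),
    compact_cocone iota h g ->
    exists! f : C -> T,
      [/\ compact_hom f, f \o c0 =1 h & forall i, f \o c i =1 g i].

(* Colimits are determined up to unique isomorphism, so the condition is stated
   for all choices of them. The homomorphism [phi] commuting with the legs is
   unique by the universal property of [A]. *)
Definition algebraically_sound (I : Type) (H : compactGroupType)
    (G : I -> compactGroupType) (iota : forall i, H -> G i) : Prop :=
  forall (A : groupType) (a0 : H -> A) (a : forall i, G i -> A)
         (C : compactGroupType) (c0 : H -> C) (c : forall i, G i -> C),
    @group_colimit I H G iota A a0 a ->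
    compact_colimit iota c0 c ->
    forall phi : A -> C,
      monoid_morphism phi -> phi \o a0 =1 c0 ->
      (forall i, phi \o a i =1 c i) ->
      injective phi.

(* Main.v *)
Require Import Defs.
From HB Require Import structures.
From mathcomp Require Import all_boot all_order all_algebra.
From mathcomp Require Import all_classical.
From mathcomp Require Import reals topology normedtype sequences.
From mathcomp Require Import ring lra Rstruct.

(* The colimit comparison is injective as soon as every nontrivial element of the
   amalgam [A] survives in some compact group receiving a cocone. Writing
   [G i = K i ><| H], an element of [A] has a normal form [x_m ... x_1 h] with
   [x_j] in [K (i_j)] nontrivial and [i_j <> i_(j+1)]. If [m = 0] the retractions
   detect it in [H]. Otherwise one builds an orthogonal representation on
   [F_0 + ... + F_m], [F_j = F_(j-1) (x) U_j], in which [G (i_j)] mixes only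
   [F_(j-1)] and [F_j] while every other summand is acted on through the
   retraction to [H]; this is possible because consecutive indices differ. Matrix
   entries then change the level by at most one, so the only contribution of the
   word from level [0] to level [m] is the product of the ascending blocks, which
   can be made nonzero.
   The mixing block is obtained from a finite-dimensional representation [U] of
   [G i] with an [H]-fixed vector moved by [x_j], by conjugating [1 + U] with an
   [H]-equivariant reflection. Such [U] come from the Peter-Weyl theorem, proved
   with the von Neumann mean as Haar integral and power iteration as spectral
   theory: normalised convolution powers of [D^v * D] converge to the projection
   onto the top eigenspace. *)

Set Implicit Arguments.
Unset Strict Implicit.
Unset Printing Implicit Defensive.

Import Order.TTheory GRing.Theory Num.Theory.
Import numFieldNormedType.Exports.

Local Open Scope classical_set_scope.
Local Open Scope ring_scope.

(** * Averages and the Haar mean *)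

Section Averages.
Variables (R : realType) (T : eqType).
Implicit Types (s t : seq T) (f g : T -> R).

Definition avg s f : R := (\sum_(z <- s) f z) / (size s)%:R.

Lemma avgD s f g : avg s (fun z => f z + g z) = avg s f + avg s g.
Proof. by rewrite /avg big_split mulrDl. Qed.

Lemma avgZ s c f : avg s (fun z => c * f z) = c * avg s f.
Proof. by rewrite /avg -mulr_sumr mulrA. Qed.

Lemma avgB s f g : avg s (fun z => f z - g z) = avg s f - avg s g.
Proof. by rewrite /avg sumrB mulrBl. Qed.

Lemma avgN s f : avg s (fun z => - f z) = - avg s f.
Proof. by rewrite /avg sumrN mulNr. Qed.

Lemma avg_cst s c : s != [::] -> avg s (fun=> c) = c.
Proof.
move=> s0; rewrite /avg big_const_seq count_predT iter_addr_0 -[c *+ _]mulr_natr mulfK//.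
by rewrite pnatr_eq0 size_eq0.
Qed.

Lemma ler_avg s f g : (forall z, f z <= g z) -> avg s f <= avg s g.
Proof. by move=> fg; rewrite ler_wpM2r ?invr_ge0 ?ler0n// ler_sum. Qed.

Lemma avg_le_cst s f c : s != [::] -> (forall z, f z <= c) -> avg s f <= c.
Proof. by move=> s0 fc; rewrite -(avg_cst c s0) ler_avg. Qed.

Lemma avg_ge_cst s f c : s != [::] -> (forall z, c <= f z) -> c <= avg s f.
Proof. by move=> s0 fc; rewrite -(avg_cst c s0) ler_avg. Qed.

Lemma avg_near s f c e :
  s != [::] -> (forall z, `|f z - c| <= e) -> `|avg s f - c| <= e.
Proof.
move=> s0 fe; rewrite ler_distl; apply/andP; split.
  by apply: avg_ge_cst => // z; have := fe z; rewrite ler_distl => /andP[].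
by apply: avg_le_cst => // z; have := fe z; rewrite ler_distl => /andP[].
Qed.

(** One sample at most [e] among [n] samples bounded by [d] lowers the bound with weight [1/n];
    iterating this makes repeated averaging contract oscillations. *)
Lemma avg_lt_max s f d e z : z \in s -> (forall w, f w <= d) -> f z <= e ->
  avg s f <= (1 - (size s)%:R^-1) * d + (size s)%:R^-1 * e.
Proof.
move=> zs fd fz; have s0 : (0 < size s)%N by case: s zs.
rewrite /avg (big_rem z)//= mulrDl addrC lerD//; last first.
  by rewrite mulrC ler_wpM2l// invr_ge0.
rewrite mulrBl mul1r.
have -> : d - (size s)%:R^-1 * d = (\sum_(i <- rem z s) d) / (size s)%:R.
  rewrite big_const_seq count_predT iter_addr_0 size_rem// -[d *+ _]mulr_natr.
  rewrite -subn1 natrB//.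
  have : (size s)%:R != 0 :> R by rewrite pnatr_eq0 -lt0n.
  by move=> ?; field.
by rewrite ler_wpM2r ?invr_ge0// ler_sum.
Qed.

End Averages.

Lemma avg_exchange (R : realType) (T U : eqType) (s : seq T) (t : seq U)
    (F : T -> U -> R) :
  avg s (fun z => avg t (F z)) = avg t (fun y => avg s (F^~ y)).
Proof. by rewrite /avg -!mulr_suml exchange_big/= mulrAC. Qed.

Lemma avg_allpairs (R : realType) (T U V : eqType) (h : T -> U -> V)
    (s : seq T) (t : seq U) (f : V -> R) :
  avg s (fun z => avg t (fun y => f (h z y))) =
  avg [seq h z y | z <- s, y <- t] f.
Proof.
rewrite /avg -mulr_suml big_allpairs_dep size_allpairs natrM invfM.
by rewrite -mulrA; congr (_ * _); rewrite mulrC.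
Qed.

Lemma avg_map (R : realType) (T U : eqType) (h : T -> U) (s : seq T)
  (f : U -> R) : avg (map h s) f = avg s (f \o h).
Proof. by rewrite /avg big_map size_map. Qed.

Lemma expr_small (R : realType) (q d e : R) : 0 <= q < 1 -> 0 < e ->
  exists k, q ^+ k * d <= e.
Proof.
move=> /andP[q0 q1] e0.
have /cvgrPdist_le/(_ _ e0) : (fun k => q ^+ k * d) @ \oo --> (0 : R).
  rewrite -[X in _ --> X](mul0r d); apply: cvgM; last exact: cvg_cst.
  by apply: cvg_expr; rewrite ger0_norm.
case=> k _ /(_ k (leqnn k)); rewrite sub0r normrN => h.
by exists k; apply: le_trans h; exact: ler_norm.
Qed.

(** * Continuity of elementary combinations of maps *)

Section Continuity.
Variable R : realType.
Variables (T U V : topologicalType).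

Lemma comp_cont (f : T -> U) (g : U -> V) :
  continuous f -> continuous g -> continuous (fun x => g (f x)).
Proof. by move=> cf cg x; exact: (continuous_comp (cf x) (cg (f x))). Qed.

Lemma pair_cont (f : T -> U) (g : T -> V) :
  continuous f -> continuous g -> continuous (fun x => (f x, g x)).
Proof. by move=> cf cg x; exact: (cvg_pair (cf x) (cg x)). Qed.

Lemma fst_cont : continuous (@fst T U).
Proof. by move=> x; exact: cvg_fst. Qed.

Lemma snd_cont : continuous (@snd T U).
Proof. by move=> x; exact: cvg_snd. Qed.

Lemma id_cont : continuous (fun x : T => x).
Proof. by move=> x; exact: cvg_id. Qed.

Lemma addr_cont (f g : T -> R) :
  continuous f -> continuous g -> continuous (fun x => f x + g x).
Proof. by move=> cf cg x; exact: (cvgD (cf x) (cg x)). Qed.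

Lemma oppr_cont (f : T -> R) : continuous f -> continuous (fun x => - f x).
Proof. by move=> cf x; exact: (cvgN (cf x)). Qed.

Lemma mulr_cont (f g : T -> R) :
  continuous f -> continuous g -> continuous (fun x => f x * g x).
Proof. by move=> cf cg x; exact: (cvgM (cf x) (cg x)). Qed.

Lemma cst_cont (c : U) : continuous (fun _ : T => c).
Proof. by move=> x; exact: cvg_cst. Qed.

Lemma sum_cont (I : Type) (s : seq I) (P : pred I) (f : I -> T -> R) :
  (forall i, continuous (f i)) -> continuous (fun x => \sum_(i <- s | P i) f i x).
Proof.
move=> cf; elim: s => [|i s ih].
  by under eq_fun do rewrite big_nil; move=> x; exact: cvg_cst.
under eq_fun do rewrite big_cons.
by case: (P i) => //; apply: addr_cont => //; exact: cf.
Qed.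

End Continuity.

Lemma mulg_cont (G : compactGroupType) (T : topologicalType) (f g : T -> G) :
  continuous f -> continuous g -> continuous (fun x => (f x * g x)%g).
Proof.
move=> cf cg.
exact: (comp_cont (pair_cont cf cg) (@mulg_continuous G)).
Qed.

Lemma invg_cont (G : compactGroupType) (T : topologicalType) (f : T -> G) :
  continuous f -> continuous (fun x => (f x)^-1%g).
Proof. by move=> cf; exact: (comp_cont cf (@invg_continuous G)). Qed.

Ltac cont := repeat first
  [ assumption
  | lazymatch goal with
    | |- continuous (fun x => x) => exact: id_cont
    | |- continuous (fun x => _ + _) => apply: addr_cont
    | |- continuous (fun x => - _) => apply: oppr_cont
    | |- continuous (fun x => _ * _) => apply: mulr_cont
    | |- continuous (fun x => (_ * _)%g) => apply: mulg_cont
    | |- continuous (fun x => (_^-1)%g) => apply: invg_cont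
    | |- continuous (fun x => (_, _)) => apply: pair_cont
    | |- continuous (fun x => \sum_(i <- _ | _) _) => apply: sum_cont => ?
    | |- continuous (fun x => x.1) => exact: fst_cont
    | |- continuous (fun x => x.2) => exact: snd_cont
    | |- continuous (fun x => ?c) => exact: cst_cont
    end
  | solve [auto]
  | match goal with |- continuous (fun x => ?f (@?h x)) =>
      apply: (@comp_cont _ _ _ h f) end
  | apply: mulg_cont | apply: invg_cont | apply: addr_cont | apply: oppr_cont
  | apply: mulr_cont | apply: pair_cont | exact: fst_cont | exact: snd_cont ].

(** The tube lemma in filter form: compactness of [K] replaces neighbourhoods of [t] depending on
    [x] by a single one. *)
Lemma compact_near (K T : topologicalType) (P : T -> K -> Prop) (t : T) :
  compact [set: K] ->
  (forall x : K, \forall y \near x & u \near t, P u y) ->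
  \forall u \near t, forall x, P u x.
Proof.
move=> /compact_near_coveringP cK h.
by apply: filterS (cK T (nbhs t) P _ (fun x _ => h x)) => u + x; exact.
Qed.

Lemma compact_groupX (G : compactGroupType) : compact [set: G * G].
Proof.
rewrite -setXTT.
by apply: compact_setX; exact: compact_group_compact.
Qed.

(** * The invariant mean on continuous functions *)

Section HaarMean.
Variables (R : realType) (G : compactGroupType).
Implicit Types (f g : G -> R) (s t : seq G).

Lemma left_uniform (F : G * G -> R) (e : R) : continuous F -> 0 < e ->
  \forall u \near (1%g : G), forall x y, `|F (x, u * y)%g - F (x, y)| <= e.
Proof.
move=> cF e0.
pose P (u : G) (z : G * G) := `|F (z.1, u * z.2)%g - F z| <= e.
suff : \forall u \near (1%g : G), forall z, P u z.
  by apply: filterS => u h x y; exact: (h (x, y)).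
apply: compact_near => [|z]; first exact: compact_groupX.
pose D (w : (G * G) * G) : R := F (w.1.1, w.2 * w.1.2)%g - F w.1.
have cD : continuous D by rewrite /D; cont.
have D0 : D (z, 1%g) = 0 by rewrite /D /= mul1g -surjective_pairing subrr.
have := cD (z, 1%g); rewrite /continuous_at => /cvgrPdist_le /(_ _ e0).
case=> -[A B] /= [nA nB] AB; exists (A, B) => //= -[x u] /= [Ax Bu].
by have := AB (x, u) (conj Ax Bu); rewrite /= D0 sub0r normrN.
Qed.

(** Compactness gives a neighbourhood [V] of the identity all of whose conjugates lie in [U], and
    finitely many right translates of [V] cover [G]. Covering [x^-1 * y] and conjugating by [x]
    gives the two-sided form. *)
Lemma translate_cover (U : set G) : nbhs (1%g : G) U ->
  exists s, forall x y : G, exists2 z, z \in s & U (y * z^-1 * x^-1)%g.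
Proof.
move=> nU.
have nV : \forall v \near (1%g : G), forall x : G, U (x * v * x^-1)%g.
  apply: compact_near => [|x]; first exact: compact_group_compact.
  have c : continuous (fun w : G * G => w.1 * w.2 * w.1^-1)%g by cont.
  have := c (x, 1%g); rewrite /continuous_at /= mulg1 mulgV => /(_ _ nU).
  by case=> -[A B] /= [nA nB] AB; exists (A, B).
pose V := [set v : G | forall x : G, U (x * v * x^-1)%g].
have cov : exists s : seq G, forall z : G, exists2 w, w \in s & V (z * w^-1)%g.
  (* Finite lists are filtered by inclusion, so that near-covering compactness yields one list good
     for every point, that is, a finite subcover. *)
  pose F := filter_from [set: seq G] (fun s => [set s' : seq G | {subset s <= s'}]).
  have FF : Filter F.
    apply: filter_from_filter; first by exists [::].
    move=> s t _ _; exists (s ++ t) => // r /= sr.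
    by split=> z zs; apply: sr; rewrite mem_cat zs ?orbT.
  have /compact_near_coveringP := @compact_group_compact G.
  case/(_ _ F (fun s z => exists2 w, w \in s & V (z * w^-1)%g) FF) => [w _|s _ sP].
    have c : continuous (fun z : G => z * w^-1)%g by cont.
    have := c w; rewrite /continuous_at mulgV => /(_ V nV) nw.
    exists ([set z | V (z * w^-1)%g], [set s' : seq G | {subset [:: (w : G)] <= s'}]).
      by split=> //; exists [:: w].
    by move=> [z s] /= [Vz ws]; exists w => //; apply: ws; rewrite inE.
  by exists s => z; exact: (sP s).
have [s sP] := cov; exists s => x y.
have [z zs] := sP (x^-1 * y)%g; rewrite /V /= => /(_ x).
by rewrite !mulgA mulgV mul1g => ?; exists z.
Qed.

(* Averaging over translates that meet every translate of a small neighbourhood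
   contracts the oscillation by the factor [1 - 1/n] and preserves the modulus
   of left uniform continuity. *)
Lemma equi_average (T : Type) (F : T -> G -> R) (B e : R) (U : set G) :
  0 < e -> nbhs (1%g : G) U -> (forall (t : T) (x : G), `|F t x| <= B) ->
  (forall (t : T) (u x : G), U u -> `|F t (u * x)%g - F t x| <= e) ->
  exists s, s != [::] /\ forall (t : T) (x y : G),
    avg s (fun z => F t (x * z)%g) - avg s (fun z => F t (y * z)%g) <= e + e.
Proof.
move=> e0 nU FB FU; have [s sP] := translate_cover nU.
have s0 : s != [::] by have [z] := sP 1%g 1%g; case: (s).
pose q : R := 1 - (size s)%:R^-1.
have n0 : (0 < size s)%N by rewrite lt0n size_eq0.
have q01 : 0 <= q < 1.
  rewrite /q subr_ge0 ltrBlDr ltrDl invr_gt0 ltr0n n0 andbT.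
  by rewrite invf_le1 ?ltr0n// ler1n.
suff step k : exists s', s' != [::] /\ (forall (t : T) (x y : G),
    avg s' (fun z => F t (x * z)%g) - avg s' (fun z => F t (y * z)%g) <=
    q ^+ k * (B + B) + e).
  have [k kP] := expr_small (B + B) q01 e0.
  have [s' [s'0 s'P]] := step k; exists s'; split=> // t x y.
  by apply: le_trans (s'P t x y) _; rewrite lerD2r.
elim: k => [|k [s' [s'0 ih]]].
  exists [:: 1%g]; split=> // t x y; rewrite /avg !big_seq1 divr1 expr0 mul1r divr1.
  rewrite !mulg1; have := FB t x; have := FB t y.
  by rewrite !ler_norml; move: e0; lra.
exists [seq (z * y)%g | z <- s, y <- s']; split.
  by rewrite -size_eq0 size_allpairs muln_eq0 !size_eq0 (negbTE s0).
move=> t x y.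
rewrite -!(avg_allpairs (fun z y : G => (z * y)%g)) /=.
pose F' (x : G) := avg s' (fun w => F t (x * w)%g).
under eq_fun do under [X in avg _ X]eq_fun do rewrite mulgA.
under [X in _ - avg _ X]eq_fun do under [X in avg _ X]eq_fun do rewrite mulgA.
have F'U u z : U u -> `|F' (u * z)%g - F' z| <= e.
  move=> Uu; rewrite -avgB -[X in `|X|]subr0; apply: avg_near => // w.
  by rewrite subr0 -mulgA FU.
have -> : avg s (fun z => F' (x * z)%g) - avg s (fun z => F' (y * z)%g) =
   avg s (fun w => avg s (fun z => F' (x * z)%g - F' (y * w)%g)).
  by under [X in _ = avg s X]eq_fun do rewrite avgB avg_cst//; rewrite avgB avg_cst.
apply: avg_le_cst => // w.
(* For fixed [w], some sample [z] makes [y * w] a left [U]-translate of [x * z], so its term is at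
   most [e]; the others obey the induction bound. *)
have [z zs Uz] := sP x (y * w)%g.
have -> : q ^+ k.+1 * (B + B) + e =
    (1 - (size s)%:R^-1) * (q ^+ k * (B + B) + e) + (size s)%:R^-1 * e.
  by rewrite exprS /q; ring.
apply: (avg_lt_max zs) => [v|]; first exact: ih.
have := F'U _ (x * z)%g Uz; rewrite !mulgA mulgVK mulgVK distrC.
exact/le_trans/ler_norm.
Qed.

Lemma continuous_bounded (T : topologicalType) (f : T -> R) :
  compact [set: T] -> continuous f -> exists B, forall x, `|f x| <= B.
Proof.
move=> cT cf.
have : compact (f @` setT).
  by apply: continuous_compact => //; apply: continuous_subspaceT.
move=> /compact_bounded /ex_strict_bound_gt0 [M _ MP].
by exists M => x; apply/ltW/MP; exists x.
Qed.

(** Von Neumann's substitute for the Haar integral: a constant in the uniform closure of the convex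
    combinations of right translates of [f]. *)
Definition rmean f (c : R) := forall e, 0 < e -> exists s, s != [::] /\
  forall x, `|avg s (fun z => f (x * z)%g) - c| <= e.

Definition lmean f (c : R) := forall e, 0 < e -> exists s, s != [::] /\
  forall x, `|avg s (fun z => f (z * x)%g) - c| <= e.

(** The double average of [f (y * z)] over both lists is close to [c] when read as a right average
    and to [d] when read as a left one. *)
Lemma lmean_rmean_eq f c d : rmean f c -> lmean f d -> c = d.
Proof.
move=> fc fd; apply/eqP; rewrite -subr_eq0 -normr_le0; apply/ler_addgt0Pl => e e0.
have e20 : 0 < e / 2 by rewrite divr_gt0.
have [s [s0 sP]] := fc _ e20; have [t [t0 tP]] := fd _ e20.
pose m := avg t (fun y => avg s (fun z => f (y * z)%g)).
have mc : `|m - c| <= e / 2 by apply: avg_near.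
have md : `|m - d| <= e / 2.
  by rewrite /m avg_exchange; apply: avg_near.
rewrite addr0; have -> : c - d = (m - d) - (m - c) by ring.
by apply: le_trans (ler_normB _ _) _; move: mc md; lra.
Qed.

Lemma rmean_inv f c : rmean f c -> lmean (fun x => f x^-1%g) c.
Proof.
move=> fc e /fc [s [s0 sP]]; exists (map (fun z : G => z^-1%g) s).
split; first by rewrite -size_eq0 size_map size_eq0.
move=> x; rewrite avg_map; under [X in avg _ X]eq_fun do rewrite /= invgM invgK.
exact: sP.
Qed.

Lemma invfK f : (fun x => f (x^-1)^-1%g) = f.
Proof. by apply/funext => x; rewrite invgK. Qed.

Lemma small_oscillation f e : continuous f -> 0 < e -> exists s, s != [::] /\
  forall x y, avg s (fun z => f (x * z)%g) - avg s (fun z => f (y * z)%g) <= e.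
Proof.
move=> cf e0.
have [B fB] := continuous_bounded (@compact_group_compact G) cf.
have e20 : 0 < e / 2 by rewrite divr_gt0.
have cF : continuous (fun w : G * G => f w.2) by cont.
have [s [s0 sP]] := equi_average (T := G) e20 (left_uniform cF e20)
  (fun _ => fB) (fun a u x h => h a x).
exists s; split=> // x y; rewrite (splitr e).
exact: (sP 1%g).
Qed.

Lemma rmean_ex f : continuous f -> exists c, rmean f c.
Proof.
move=> cf.
(* The right mean will be the supremum of the uniform lower bounds reached by right averages. *)
pose A := [set m : R | exists s, s != [::] /\
  forall x, m <= avg s (fun z => f (x * z)%g)].
have cfV : continuous (fun x => f x^-1%g) by cont.
have left_osc e : 0 < e -> exists t, t != [::] /\
    forall x y, avg t (fun z => f (z * x)%g) - avg t (fun z => f (z * y)%g) <= e.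
  move=> /(small_oscillation cfV) [s [s0 sP]]; exists (map (fun z : G => z^-1%g) s); split.
    by rewrite -size_eq0 size_map size_eq0.
  move=> x y; have := sP x^-1%g y^-1%g; rewrite !avg_map.
  by under eq_fun do rewrite invgM invgK;
     under [X in _ - avg _ X]eq_fun do rewrite invgM invgK.
(* Nearly constant left averages bound [A] from above: the exchanged double average dominates [m]
   and exceeds any value of the left average by at most [e]. *)
have A_le e : 0 < e -> exists t, t != [::] /\
    forall m x, A m -> m <= avg t (fun z => f (z * x)%g) + e.
  move=> /left_osc [t [t0 tP]]; exists t; split=> // m x [s [s0 sP]].
  apply: (@le_trans _ _ (avg s (fun z => avg t (fun y => f (y * z)%g)))).
    by rewrite avg_exchange; exact: avg_ge_cst.
  by apply: avg_le_cst => // z; have := tP z x; lra.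
have A0 : A !=set0.
  have [B fB] := continuous_bounded (@compact_group_compact G) cf.
  exists (- B), [:: 1%g]; split=> // x; rewrite /avg big_seq1 divr1 mulg1.
  by have := fB x; rewrite ler_norml => /andP[].
have uA : has_ubound A.
  have [t [_ tP]] := A_le 1 ltr01.
  by exists (avg t (fun z => f (z * 1)%g) + 1) => m /tP.
exists (sup A) => e e0; have e20 : 0 < e / 2 by rewrite divr_gt0.
have [s [s0 sP]] := small_oscillation cf e20; exists s; split=> // x.
have [t [t0 tP]] := A_le _ e20.
rewrite ler_distl; apply/andP; split.
  rewrite lerBlDr; apply: ge_sup => // m Am.
  apply: (@le_trans _ _ (avg s (fun z => avg t (fun y => f (y * z)%g)) + e / 2)).
    rewrite -lerBlDr; apply: avg_ge_cst => // z.
    by rewrite lerBlDr; exact: tP.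
  rewrite [X in _ <= _ + X](splitr e) addrA lerD2r avg_exchange; apply: avg_le_cst => // y.
  by have := sP y x; lra.
rewrite -lerBlDr; apply: ub_le_sup => //; exists s; split=> // y.
by have := sP x y; move: e0; lra.
Qed.

Lemma lmean_ex f : continuous f -> exists c, lmean f c.
Proof.
move=> cf; have [|c] := @rmean_ex (fun x => f x^-1%g); first by cont.
by move=> /rmean_inv; rewrite invfK; exists c.
Qed.

(** [0] is a junk value for functions without a right mean; a continuous function has exactly
    one. *)
Definition mean f : R := xget 0 (rmean f).

Lemma rmean_mean f : continuous f -> rmean f (mean f).
Proof.
move=> /rmean_ex [c fc]; rewrite /mean.
by case: xgetP => // /(_ c).
Qed.

Lemma lmean_mean f : continuous f -> lmean f (mean f).
Proof.
move=> cf; have [d fd] := lmean_ex cf.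
by rewrite (lmean_rmean_eq (rmean_mean cf) fd).
Qed.

Lemma mean_rE f c : continuous f -> rmean f c -> mean f = c.
Proof. by move=> cf fc; rewrite (lmean_rmean_eq fc (lmean_mean cf)). Qed.

Lemma mean_lE f c : continuous f -> lmean f c -> mean f = c.
Proof. by move=> cf fc; rewrite -(lmean_rmean_eq (rmean_mean cf) fc). Qed.

Lemma mean_left f (a : G) : continuous f -> mean (fun x => f (a * x)%g) = mean f.
Proof.
move=> cf; apply: mean_rE; first by cont.
move=> e /(rmean_mean cf) [s [s0 sP]]; exists s; split=> // x.
by under [X in avg _ X]eq_fun do rewrite mulgA.
Qed.

Lemma mean_inv f : continuous f -> mean (fun x => f x^-1%g) = mean f.
Proof.
by move=> cf; apply: mean_lE; [cont|apply: rmean_inv; exact: rmean_mean].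
Qed.

Lemma mean_cst c : mean (fun=> c) = c.
Proof.
apply: mean_rE; first exact: cst_cont.
by move=> e e0; exists [:: 1%g]; split=> // x; rewrite avg_cst// subrr normr0 ltW.
Qed.

(** After exchanging the two averages, a list good for the left mean of [f] is also good for the
    averaged function. *)
Lemma mean_avg f s : s != [::] -> continuous f ->
  mean (fun x => avg s (fun z => f (x * z)%g)) = mean f.
Proof.
move=> s0 cf; apply: mean_lE; first by rewrite /avg; cont.
move=> e /(lmean_mean cf) [t [t0 tP]]; exists t; split=> // x.
rewrite avg_exchange; apply: avg_near => // z.
by under [X in avg _ X]eq_fun do rewrite -mulgA.
Qed.

Lemma meanD f g : continuous f -> continuous g ->
  mean (fun x => f x + g x) = mean f + mean g.
Proof.
move=> cf cg; apply: mean_rE; first by cont.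
move=> e e0; have e20 : 0 < e / 2 by rewrite divr_gt0.
have [s [s0 sP]] := rmean_mean cf e20.
(* [s] flattens [f], and [t] then flattens [g] already averaged over [s]. The list of products
   serves both, since further averaging keeps [f] flat. *)
pose g' x := avg s (fun z => g (x * z)%g).
have cg' : continuous g' by rewrite /g' /avg; cont.
have [t [t0 tP]] := rmean_mean cg' e20.
rewrite mean_avg// in tP.
exists [seq (z * y)%g | z <- t, y <- s]; split.
  by rewrite -size_eq0 size_allpairs muln_eq0 !size_eq0 (negbTE t0).
move=> x; rewrite -(avg_allpairs (fun z y : G => (z * y)%g)) /=.
have -> : (fun z => avg s (fun y : G => f (x * (z * y))%g + g (x * (z * y))%g)) =
          (fun z => avg s (fun y => f (x * z * y)%g) + g' (x * z)%g).
  apply/funext => z; rewrite avgD; congr (_ + _).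
    by under eq_fun do rewrite mulgA.
  by rewrite /g'; under eq_fun do rewrite mulgA.
rewrite avgD.
have : `|avg t (fun z => avg s (fun y => f (x * z * y)%g)) - mean f| <= e / 2.
  exact: avg_near.
have := tP x; rewrite !ler_distl.
set a := avg t _; set b := avg t _; lra.
Qed.

Lemma meanZ c f : continuous f -> mean (fun x => c * f x) = c * mean f.
Proof.
move=> cf; apply: mean_rE; first by cont.
(* The added [1] covers the case [c = 0]. *)
move=> e e0; have d0 : 0 < e / (`|c| + 1) by rewrite divr_gt0// ltr_wpDl.
have [s [s0 sP]] := rmean_mean cf d0; exists s; split=> // x.
rewrite avgZ -mulrBr normrM.
apply: (@le_trans _ _ ((`|c| + 1) * (e / (`|c| + 1)))).
  by apply: ler_pM => //; rewrite lerDl.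
have : `|c| + 1 != 0 by rewrite gt_eqF// ltr_wpDl.
by move=> ?; rewrite mulrC mulfVK.
Qed.

Lemma meanN f : continuous f -> mean (fun x => - f x) = - mean f.
Proof.
move=> cf; rewrite -mulN1r -meanZ//; congr mean; apply/funext => x.
by rewrite mulN1r.
Qed.

Lemma meanB f g : continuous f -> continuous g ->
  mean (fun x => f x - g x) = mean f - mean g.
Proof. by move=> cf cg; rewrite meanD ?meanN//; cont. Qed.

Lemma mean_sum (I : Type) (r : seq I) (P : pred I) (F : I -> G -> R) :
  (forall i, continuous (F i)) ->
  mean (fun x => \sum_(i <- r | P i) F i x) = \sum_(i <- r | P i) mean (F i).
Proof.
move=> cF; elim: r => [|i r ih].
  by under eq_fun do rewrite big_nil; rewrite mean_cst big_nil.
under eq_fun do rewrite big_cons; rewrite big_cons.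
by case: (P i) => //; rewrite meanD ?ih//; cont.
Qed.

Lemma mean_ge0 f : continuous f -> (forall x, 0 <= f x) -> 0 <= mean f.
Proof.
move=> cf f0; apply/ler_addgt0Pl => e /(rmean_mean cf) [s [s0 sP]].
have := sP 1%g; rewrite ler_distl => /andP[_]; rewrite addrC; apply: le_trans.
exact: avg_ge_cst.
Qed.

Lemma mean_le f g : continuous f -> continuous g -> (forall x, f x <= g x) ->
  mean f <= mean g.
Proof.
move=> cf cg fg; rewrite -subr_ge0 -meanB//; apply: mean_ge0; first by cont.
by move=> x; rewrite subr_ge0.
Qed.

Lemma mean_near f c e : continuous f -> (forall x, `|f x - c| <= e) ->
  `|mean f - c| <= e.
Proof.
move=> cf fe; rewrite ler_distl -[c - e]mean_cst -[c + e]mean_cst.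
by apply/andP; split; apply: mean_le => //; try exact: cst_cont; move=> x;
   have := fe x; rewrite ler_distl => /andP[].
Qed.

(** Finitely many right translates of the region where [f] exceeds [f a / 2] cover the group, so
    some average of right translates of [f] is bounded below by a positive constant; by [mean_avg]
    its mean is that of [f]. *)
Lemma mean_gt0 f (a : G) : continuous f -> (forall x, 0 <= f x) -> 0 < f a ->
  0 < mean f.
Proof.
move=> cf f0 fa.
have [s sP] : exists s, forall x : G, exists2 z, z \in s & f a / 2 < f (x * z)%g.
  have nU : nbhs (1%g : G) [set u | f a / 2 < f (u * a)%g].
    have c : continuous (fun u : G => f (u * a)%g) by cont.
    have := c 1%g; rewrite /continuous_at mul1g => h.
    by apply: (cvgr_gt _ h); rewrite ltr_pdivrMr// ltr_pMr// ltr1n.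
  have [s sP] := translate_cover nU; exists (map (fun z : G => z^-1 * a)%g s) => x.
  have [z zs] := sP 1%g x; rewrite /= invg1 mulg1 -mulgA => h.
  by exists (z^-1 * a)%g => //; apply: map_f.
have s0 : s != [::] by have [z] := sP 1%g; case: (s).
rewrite -(mean_avg s0 cf).
have n0 : 0 < (size s)%:R^-1 :> R by rewrite invr_gt0 ltr0n lt0n size_eq0.
have fs x : (size s)%:R^-1 * (f a / 2) <= avg s (fun z => f (x * z)%g).
  (* [avg_lt_max] is applied to [- f], with upper bound [0]. *)
  have [z zs fz] := sP x; rewrite -lerN2 -[leRHS]mulrN.
  rewrite -avgN.
  have -> : (size s)%:R^-1 * - (f a / 2) =
    (1 - (size s)%:R^-1) * 0 + (size s)%:R^-1 * - (f a / 2) by rewrite mulr0 add0r.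
  by apply: (avg_lt_max zs) => [w|]; rewrite ?oppr_le0// lerN2 ltW.
apply: (@lt_le_trans _ _ ((size s)%:R^-1 * (f a / 2))).
  by rewrite mulr_gt0// divr_gt0.
rewrite -[leLHS]mean_cst; apply: mean_le => //; first exact: cst_cont.
by rewrite /avg; cont.
Qed.

Lemma mean_cont (T : topologicalType) (F : T * G -> R) : continuous F ->
  continuous (fun t : T => mean (fun x => F (t, x))).
Proof.
move=> cF t; rewrite /continuous_at; apply/cvgrPdist_le => e e0.
have : \forall t' \near t, forall x : G, `|F (t, x) - F (t', x)| <= e.
  apply: compact_near => [|x]; first exact: compact_group_compact.
  have cD : continuous (fun w : T * G => F (t, w.2) - F w) by cont.
  have := cD (t, x); rewrite /continuous_at /= subrr => /cvgrPdist_le /(_ _ e0).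
  case=> -[A B] /= [nA nB] AB; exists (B, A) => //= -[y t'] /= [By At'].
  by have /= := AB (t', y) (conj At' By); rewrite sub0r normrN.
apply: filterS => t' h; rewrite -meanB; [|cont|cont].
by rewrite -[X in `|X|]subr0; apply: mean_near => [|x]; [cont|rewrite subr0].
Qed.

(** Fubini: equicontinuity provides one list approximating the means of all slices of [F] at once,
    and the exchange reduces to linearity over a finite sum. *)
Lemma mean_exchange (F : G * G -> R) : continuous F ->
  mean (fun a => mean (fun b => F (a, b))) =
  mean (fun b => mean (fun a => F (a, b))).
Proof.
move=> cF; apply/eqP; rewrite -subr_eq0 -normr_le0; apply/ler_addgt0Pl => e e0.
have e40 : 0 < e / 4 by rewrite divr_gt0.
pose I a := mean (fun b => F (a, b)); pose J b := mean (fun a => F (a, b)).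
have cI : continuous I by exact: mean_cont.
have cJ : continuous J.
  by apply: (@mean_cont _ (fun w => F (w.2, w.1))); cont.
have [B FB] := continuous_bounded (@compact_groupX G) cF.
(* [None] adds the partial mean [J] to the family of slices, so that the same list serves both
   iterated means. *)
pose H (o : option G) (b : G) := if o is Some a then F (a, b) else J b.
have cH o : continuous (H o) by case: o => [a|] //=; rewrite /H; cont.
have HB o b : `|H o b| <= B.
  case: o => [a|] /=; first exact: FB.
  rewrite -[X in `|X|]subr0; apply: mean_near => [|a]; first by cont.
  by rewrite subr0.
have [s [s0 sP]] : exists s, s != [::] /\ forall (o : option G) (x y : G),
    avg s (fun z => H o (x * z)%g) - avg s (fun z => H o (y * z)%g) <=
    e / 4 + e / 4.
  apply: (equi_average e40 (left_uniform cF e40) HB).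
  move=> [a|] u x /= h; first exact: h.
  rewrite /J -meanB; [|cont|cont].
  by rewrite -[X in `|X|]subr0; apply: mean_near => [|a]; [cont|rewrite subr0].
have sH o : `|avg s (fun z => H o (1 * z)%g) - mean (H o)| <= e / 2.
  rewrite -(mean_avg s0 (cH o)) distrC; apply: mean_near => [|x].
    by have cHo := cH o; rewrite /avg; cont.
  have := sP o x 1%g; have := sP o 1%g x.
  by rewrite ler_norml; set u := avg _ _; set v := avg _ _; lra.
pose m := avg s J.
have mJ : `|m - mean J| <= e / 2.
  by have := sH None; under [X in avg _ X]eq_fun do rewrite mul1g.
have mI : `|mean I - m| <= e / 2.
  have -> : m = mean (fun a => avg s (fun z => F (a, z))).
    rewrite /m /avg; under [in RHS]eq_fun do rewrite mulrC.
    by rewrite meanZ ?mean_sum; [rewrite mulrC|move=> z; cont|cont].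
  rewrite -meanB//; last by rewrite /avg; cont.
  rewrite -[X in `|X|]subr0; apply: mean_near => [|a]; first by rewrite /avg; cont.
  rewrite subr0 distrC; have := sH (Some a).
  by under [X in avg _ X]eq_fun do rewrite mul1g.
rewrite addr0; have -> : mean I - mean J = (mean I - m) + (m - mean J) by ring.
by apply: le_trans (ler_normD _ _) _; move: mI mJ; lra.
Qed.

End HaarMean.

(** * Convolution *)

Lemma uniform_limit (R : realType) (T : topologicalType) (u : nat -> T -> R) :
  (forall n, continuous (u n)) ->
  (forall e, 0 < e -> exists N, forall n m x, (N <= n)%N -> (N <= m)%N ->
     `|u n x - u m x| <= e) ->
  exists2 f : T -> R, continuous f &
    forall e, 0 < e -> exists N, forall n x, (N <= n)%N -> `|u n x - f x| <= e.
Proof.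
move=> cu uC; pose f x := lim (u^~ x @ \oo).
have ucv x : cvg (u^~ x @ \oo).
  apply/cauchy_cvgP.
  apply/cauchyP => e e0.
  have e20 : 0 < e / 2 by rewrite divr_gt0.
  have [N NP] := uC _ e20; exists (u N x); exists N => // n /= Nn.
  rewrite /ball /= (le_lt_trans (NP _ _ _ (leqnn N) Nn))//.
  by rewrite ltr_pdivrMr// ltr_pMr// ltr1n.
have fP e : 0 < e -> exists N, forall n x, (N <= n)%N -> `|u n x - f x| <= e.
  move=> e0; have e20 : 0 < e / 2 by rewrite divr_gt0.
  have [N NP] := uC _ e20; exists N => n x Nn.
  have /cvgrPdist_le /(_ _ e20) [M _ MP] : u^~ x @ \oo --> f x by exact: ucv.
  have := NP n (maxn N M) x Nn (leq_maxl _ _).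
  have := MP (maxn N M) (leq_maxr _ _).
  by rewrite /= !ler_distl; set a := u (maxn _ _) _; lra.
exists f => // x; rewrite /continuous_at; apply/cvgrPdist_le => e e0.
have e30 : 0 < e / 3 by rewrite divr_gt0.
have [N NP] := fP _ e30.
have /cvgrPdist_le /(_ _ e30) : u N y @[y --> x] --> u N x by exact: cu.
apply: filterS => y; have := NP N x (leqnn N); have := NP N y (leqnn N).
by rewrite !ler_distl; lra.
Qed.

Section Convolution.
Variables (R : realType) (G : compactGroupType).
Implicit Types (f g h : G -> R) (a b x y : G).

Definition dot f g : R := mean (fun x => f x * g x).
Definition conv f g y : R := mean (fun b => f b * g (b^-1 * y)%g).
Definition vee f x : R := f x^-1%g.
Definition ltrans a f x : R := f (a^-1 * x)%g.

Lemma vee_cont f : continuous f -> continuous (vee f).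
Proof. by move=> cf; rewrite /vee; cont. Qed.

Lemma ltrans_cont a f : continuous f -> continuous (ltrans a f).
Proof. by move=> cf; rewrite /ltrans; cont. Qed.

Lemma conv_cont f g : continuous f -> continuous g -> continuous (conv f g).
Proof.
move=> cf cg; rewrite /conv.
by apply: (@mean_cont _ _ _ (fun w => f w.2 * g (w.2^-1 * w.1)%g)); cont.
Qed.

Hint Resolve vee_cont ltrans_cont conv_cont : core.

Lemma veeK f : vee (vee f) = f.
Proof. by apply/funext => x; rewrite /vee invgK. Qed.

Lemma dotC f g : dot f g = dot g f.
Proof. by rewrite /dot; under eq_fun do rewrite mulrC. Qed.

Lemma dotDl f g h : continuous f -> continuous g -> continuous h ->
  dot (fun x => f x + g x) h = dot f h + dot g h.
Proof.
move=> cf cg ch; rewrite /dot -meanD; [|cont|cont].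
by under eq_fun do rewrite mulrDl.
Qed.

Lemma dotZl c f g : continuous f -> continuous g ->
  dot (fun x => c * f x) g = c * dot f g.
Proof.
move=> cf cg; rewrite /dot -meanZ; last by cont.
by under eq_fun do rewrite -mulrA.
Qed.

Lemma dotBl f g h : continuous f -> continuous g -> continuous h ->
  dot (fun x => f x - g x) h = dot f h - dot g h.
Proof.
move=> cf cg ch; rewrite /dot -meanB; [|cont|cont].
by under eq_fun do rewrite mulrBl.
Qed.

Lemma dot_suml (I : Type) (r : seq I) (P : pred I) (c : I -> R) (F : I -> G -> R) g :
  (forall i, continuous (F i)) -> continuous g ->
  dot (fun x => \sum_(i <- r | P i) c i * F i x) g =
  \sum_(i <- r | P i) c i * dot (F i) g.
Proof.
move=> cF cg; rewrite /dot; under eq_fun do rewrite mulr_suml.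
rewrite mean_sum; last by move=> i; cont.
by apply: eq_bigr => i _; exact: dotZl.
Qed.

Lemma dot0l g : dot (fun=> 0) g = 0.
Proof. by rewrite /dot; under eq_fun do rewrite mul0r; rewrite mean_cst. Qed.

Lemma dot_ge0 f : continuous f -> 0 <= dot f f.
Proof.
move=> cf; apply: mean_ge0 => [|x]; first by cont.
by rewrite -expr2 sqr_ge0.
Qed.

Lemma dot_gt0 f x : continuous f -> f x != 0 -> 0 < dot f f.
Proof.
move=> cf fx; apply: (@mean_gt0 _ _ _ x) => [|y|]; first by cont.
  by rewrite -expr2 sqr_ge0.
by rewrite -expr2 exprn_even_gt0.
Qed.

Lemma dot_cauchy_schwarz f g : continuous f -> continuous g ->
  dot f g ^+ 2 <= dot f f * dot g g.
Proof.
move=> cf cg; have cs (t : R) : 0 <= dot f f + t * dot f g *+ 2 + t ^+ 2 * dot g g.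
  pose h x := f x + t * g x.
  have ch : continuous h by rewrite /h; cont.
  suff -> : dot f f + t * dot f g *+ 2 + t ^+ 2 * dot g g = dot h h by exact: dot_ge0.
  have ctg : continuous (fun x => t * g x) by cont.
  rewrite dotDl// [dot f h]dotC [dot (fun x => t * g x) h]dotC !dotDl//.
  rewrite (dotC f (fun x => t * g x)) !dotZl// (dotC g (fun x => t * g x)).
  by rewrite dotZl// (dotC g f); ring.
have gg := dot_ge0 cg; have ff := dot_ge0 cf.
have [g0|g0] := eqVneq (dot g g) 0.
  rewrite g0 mulr0; have := cs (- (dot f f + 1) / 2 * dot f g).
  rewrite g0 mulr0 addr0 => h; have : 0 <= dot f g ^+ 2 by exact: sqr_ge0.
  have {}h : 0 <= dot f f - (dot f f + 1) * dot f g ^+ 2.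
    by move: h; congr (0 <= _); field.
  have [->//|fg0] := eqVneq (dot f g) 0; first by rewrite expr0n.
  (* With [dot g g = 0] the quadratic is affine in [t]; this value of [t] makes it [-1]. *)
  exfalso; have := cs (- (dot f f + 1) / (2 * dot f g)).
  rewrite g0 mulr0 addr0.
  have -> : - (dot f f + 1) / (2 * dot f g) * dot f g *+ 2 = - (dot f f + 1).
    by field.
  by lra.
have g1 : 0 < dot g g by rewrite lt_neqAle eq_sym g0.
(* The minimiser of the quadratic. *)
have := cs (- dot f g / dot g g).
have -> : dot f f + - dot f g / dot g g * dot f g *+ 2 +
  (- dot f g / dot g g) ^+ 2 * dot g g = dot f f - dot f g ^+ 2 / dot g g.
  by field.
by rewrite subr_ge0 ler_pdivrMr.
Qed.

Lemma dot_ltrans a f g : continuous f -> continuous g ->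
  dot (ltrans a f) (ltrans a g) = dot f g.
Proof. by move=> cf cg; apply: (@mean_left _ _ (fun x => f x * g x)); cont. Qed.

Lemma dot_vee f g : continuous f -> continuous g ->
  dot (vee f) (vee g) = dot f g.
Proof. by move=> cf cg; apply: (@mean_inv _ _ (fun x => f x * g x)); cont. Qed.

Lemma ltransM a b f : ltrans (a * b)%g f = ltrans a (ltrans b f).
Proof. by apply/funext => x; rewrite /ltrans invgM mulgA. Qed.

Lemma ltrans1 f : ltrans 1%g f = f.
Proof. by apply/funext => x; rewrite /ltrans invg1 mul1g. Qed.

Lemma dot_ltransV a f g : continuous f -> continuous g ->
  dot (ltrans a f) g = dot f (ltrans a^-1%g g).
Proof.
move=> cf cg; rewrite -[RHS](@dot_ltrans a)//; last by auto.
by rewrite -ltransM mulgV ltrans1.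
Qed.

(** The inner-product form makes translations and Cauchy-Schwarz available for convolutions. *)
Lemma convE f g y : conv f g y = dot f (ltrans y (vee g)).
Proof.
rewrite /conv /dot; congr mean; apply/funext => b.
by rewrite /ltrans /vee invgM invgK.
Qed.

Lemma dot_conv f g : dot f g = conv f (vee g) 1%g.
Proof. by rewrite convE veeK ltrans1. Qed.

Lemma dot_convV f g : continuous f -> continuous g -> dot f g = conv (vee f) g 1%g.
Proof. by move=> cf cg; rewrite -dot_vee// dot_conv veeK. Qed.

Lemma ltrans_conv a f g : continuous f -> continuous g ->
  ltrans a (conv f g) = conv (ltrans a f) g.
Proof.
move=> cf cg; apply/funext => y; rewrite {1}/ltrans !convE dot_ltransV//; last by auto.
by rewrite -ltransM.
Qed.

Lemma vee_conv f g : continuous f -> continuous g ->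
  vee (conv f g) = conv (vee g) (vee f).
Proof.
move=> cf cg; apply/funext => y; rewrite {1}/vee !convE veeK dotC.
by rewrite dot_ltransV ?invgK//; auto.
Qed.

Lemma convA f g h : continuous f -> continuous g -> continuous h ->
  conv (conv f g) h = conv f (conv g h).
Proof.
move=> cf cg ch; apply/funext => y; rewrite /conv.
transitivity (mean (fun c => mean (fun b => f b * g (b^-1 * c)%g * h (c^-1 * y)%g))).
  congr mean; apply/funext => c; rewrite mulrC -meanZ; last by cont.
  by under [in RHS]eq_fun do rewrite mulrC.
rewrite (@mean_exchange _ _ (fun w => f w.2 * g (w.2^-1 * w.1)%g * h (w.1^-1 * y)%g));
  last by cont.
congr mean; apply/funext => b /=; rewrite -meanZ; last by cont.
(* Left invariance substitutes [b * c] for [c]. *)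
rewrite -[LHS](@mean_left _ _ _ b); last by cont.
by under eq_fun do rewrite mulgA mulVg mul1g invgM -mulgA -mulrA.
Qed.

Lemma conv_bound f g y : continuous f -> continuous g ->
  conv f g y ^+ 2 <= dot f f * dot g g.
Proof.
move=> cf cg; rewrite convE.
have -> : dot g g = dot (ltrans y (vee g)) (ltrans y (vee g)).
  by rewrite dot_ltrans ?dot_vee//; auto.
by apply: dot_cauchy_schwarz; auto.
Qed.

(** The Cauchy-Schwarz bound is uniform in the point, and the mean has total mass one. *)
Lemma dot_conv_le f g : continuous f -> continuous g ->
  dot (conv f g) (conv f g) <= dot f f * dot g g.
Proof.
move=> cf cg; rewrite -[leRHS](@mean_cst R G); apply: mean_le.
- by have := conv_cont cf cg; cont.
- exact: cst_cont.
- by move=> x; rewrite -expr2 conv_bound.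
Qed.

Lemma convZl c f g : continuous f -> continuous g ->
  conv (fun x => c * f x) g = (fun y => c * conv f g y).
Proof. by move=> cf cg; apply/funext => y; rewrite !convE dotZl//; auto. Qed.

Lemma convZr c f g : continuous f -> continuous g ->
  conv f (fun x => c * g x) = (fun y => c * conv f g y).
Proof.
move=> cf cg; apply/funext => y; rewrite /conv -meanZ; last by cont.
by under eq_fun do rewrite mulrCA.
Qed.

Lemma convBl f g h : continuous f -> continuous g -> continuous h ->
  conv (fun x => f x - g x) h = (fun y => conv f h y - conv g h y).
Proof. by move=> cf cg ch; apply/funext => y; rewrite !convE dotBl//; auto. Qed.

Lemma conv_bound_sup f g B e y : continuous f -> continuous g ->
  (forall x, `|f x| <= e) -> (forall x, `|g x| <= B) -> `|conv f g y| <= e * B.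
Proof.
move=> cf cg fe gB; rewrite -[X in `|X|]subr0; apply: mean_near => [|x].
  by cont.
by rewrite subr0 normrM ler_pM.
Qed.

End Convolution.

#[export] Hint Resolve vee_cont ltrans_cont conv_cont : core.

(** * The Peter-Weyl theorem *)

Section TopEigenprojection.
Variables (R : realType) (G : compactGroupType) (sigma : G -> R).
Hypotheses (sigma_cont : continuous sigma) (vee_sigma : vee sigma = sigma).
Variable x0 : G.
Hypothesis sigma_neq0 : sigma x0 != 0.

(* [cpow n] is the convolution power of exponent [n.+1]. *)
Fixpoint cpow n : G -> R := if n is m.+1 then conv sigma (cpow m) else sigma.

Let q n := dot (cpow n) (cpow n).

Let cpow_cont n : continuous (cpow n).
Proof. by elim: n => //= n ih; auto. Qed.

Hint Resolve cpow_cont : core.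

Let conv_cpow n m : conv (cpow n) (cpow m) = cpow (n + m).+1.
Proof. by elim: n => [|n ih] //=; rewrite convA//= ih. Qed.

Let vee_cpow n : vee (cpow n) = cpow n.
Proof.
elim: n => [|n ih] //=; rewrite vee_conv// ih vee_sigma.
by rewrite -[sigma]/(cpow 0) conv_cpow addn0 conv_cpow add0n.
Qed.

Let dot_cpow n m : dot (cpow n) (cpow m) = cpow (n + m).+1 1%g.
Proof. by rewrite dot_conv vee_cpow conv_cpow. Qed.

(** Cauchy-Schwarz for the powers of exponents [n + 1] and [n + 3]: inner products of powers depend
    only on the sum of the exponents. *)
Let q_convex n : q n.+1 ^+ 2 <= q n * q n.+2.
Proof.
have := dot_cauchy_schwarz (@cpow_cont n) (@cpow_cont n.+2).
by rewrite /q !dot_cpow !addSn !addnS.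
Qed.

Let q_mul n m : q (n + m).+1 <= q n * q m.
Proof. by rewrite /q -conv_cpow; exact: dot_conv_le. Qed.

Let q_gt0 n : 0 < q n.
Proof.
(* Consecutive values are carried in pairs, since [q_convex] relates three of them. *)
suff : 0 < q n /\ 0 < q n.+1 by case.
have q0 : 0 < q 0%N by exact: (dot_gt0 (x := x0)).
elim: n => [|n [ih1 ih2]]; split => //.
  apply: (dot_gt0 (x := 1%g)) => //.
  by rewrite -[1%N]/((0 + 0).+1) -dot_cpow gt_eqF.
rewrite ltNge; apply/negP => h.
have := q_convex n; rewrite leNgt => /negP; apply.
by rewrite (le_lt_trans (mulr_ge0_le0 (ltW ih1) h))// exprn_gt0.
Qed.

(** By log-convexity these ratios increase; their supremum [mu] is the largest eigenvalue of
    convolution with [conv sigma sigma]. *)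
Let r n := q n.+1 / q n.

Let r_nd : nondecreasing_seq r.
Proof.
apply/nondecreasing_seqP => n; rewrite /r.
by rewrite ler_pdivrMr// mulrAC ler_pdivlMr// -expr2 mulrC q_convex.
Qed.

Let r_le n : r n <= q 0%N.
Proof. by rewrite ler_pdivrMr// mulrC; have := q_mul n 0; rewrite addn0. Qed.

Let r_gt0 n : 0 < r n. Proof. exact: divr_gt0. Qed.

Let mu := sup (range r).

Let r_sup : has_sup (range r).
Proof.
split; first by exists (r 0%N), 0%N.
by exists (q 0%N) => _ [n _ <-].
Qed.

Let r_mu n : r n <= mu.
Proof. by apply: ub_le_sup; [exact: r_sup.2|exists n]. Qed.

Let mu_gt0 : 0 < mu. Proof. exact: lt_le_trans (r_gt0 0) (r_mu 0). Qed.

Let q_ge_pow m k : r m ^+ k * q m <= q (m + k)%N.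
Proof.
elim: k => [|k ih]; first by rewrite expr0 mul1r addn0.
rewrite exprS -mulrA addnS.
apply: (@le_trans _ _ (r m * q (m + k)%N)).
  by rewrite ler_wpM2l// ltW.
by rewrite -ler_pdivlMr//; apply: r_nd; rewrite leq_addr.
Qed.

(* Submultiplicativity of the Hilbert-Schmidt norm: the top eigenvalue has
   multiplicity at least one. *)
Let mu_pow k : mu ^+ k.+1 <= q k.
Proof.
have rk m : r m ^+ k.+1 <= q k.
  rewrite -(@ler_pM2r _ (q m))// mulrC [leRHS]mulrC.
  by rewrite mulrC; apply: le_trans (q_ge_pow m k.+1) _; rewrite addnS.
have rmu : r @ \oo --> mu.
  by apply: nondecreasing_cvgn => //; exact: r_sup.2.
have rX j : (fun m => r m ^+ j) @ \oo --> mu ^+ j.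
  elim: j => [|j ih]; first by rewrite expr0; exact: cvg_cst.
  rewrite exprS; under eq_fun do rewrite exprS; exact: cvgM.
by apply: (cvgr_to_le (rX k.+1)); exact: nearW.
Qed.

(** Spectrally, the sum of [(lambda / mu) ^+ n.+1] over the eigenvalues [lambda] of convolution with
    [conv sigma sigma], counted with multiplicity; it decreases to the multiplicity of [mu]. *)
Let b n := q n / mu ^+ n.+1.

Let b_ge1 n : 1 <= b n.
Proof. by rewrite ler_pdivlMr ?exprn_gt0// mul1r. Qed.

Let b_ni : nonincreasing_seq b.
Proof.
apply/nonincreasing_seqP => n; rewrite /b [mu ^+ n.+2]exprS invfM mulrA.
apply: ler_wpM2r; first by rewrite invr_ge0 exprn_ge0// ltW.
by rewrite ler_pdivrMr// mulrC -ler_pdivrMr// r_mu.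
Qed.

(** The index [(n + n).+1] stands for exponent [2 * n.+1]. Only even powers occur, so the signs of
    the eigenvalues of [sigma] do not matter. *)
Let f_ n (x : G) : R := (mu ^+ n.+1)^-1 * cpow (n + n).+1 x.

Let f_cont n : continuous (f_ n).
Proof. by apply: mulr_cont; [exact: cst_cont|exact: cpow_cont]. Qed.

Let f_subr_cont n m : continuous (fun x => f_ n x - f_ m x).
Proof. by apply: addr_cont => //; exact: oppr_cont. Qed.

Hint Resolve f_cont : core.

Let dot_f n m : dot (f_ n) (f_ m) = b (n + m).+1.
Proof.
rewrite dotZl// dotC dotZl// dotC dot_cpow /b /q dot_cpow.
have -> : ((n + n).+1 + (m + m).+1).+1 = ((n + m).+1 + (n + m).+1).+1.
  by rewrite !(addnS, addSn) addnACA.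
have -> : mu ^+ (n + m).+2 = mu ^+ n.+1 * mu ^+ m.+1.
  by rewrite -exprD addSn addnS.
by rewrite invfM mulrA [RHS]mulrC.
Qed.

(** The squared distance expands to [b (2n+1) - 2 b (n+m+1) + b (2m+1)], and [b] decreases to a
    limit. *)
Let f_cauchy e : 0 < e -> exists N, forall n m, (N <= n)%N -> (N <= m)%N ->
  dot (fun x => f_ n x - f_ m x) (fun x => f_ n x - f_ m x) <= e.
Proof.
move=> e0; have bcv : b @ \oo --> inf (range b).
  apply: nonincreasing_cvgn => //; exists 0 => _ [n _ <-].
  exact: le_trans ler01 (b_ge1 n).
have b_inf n : inf (range b) <= b n.
  apply: ge_inf; last by exists n.
  by exists 0 => _ [k _ <-]; exact: le_trans ler01 (b_ge1 k).
have e20 : 0 < e / 2 by rewrite divr_gt0.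
have /cvgrPdist_le /(_ _ e20) [N _ NP] := bcv.
exists N => n m Nn Nm.
have cd := @f_subr_cont n m.
rewrite dotBl// [dot (f_ n) _]dotC [dot (f_ m) _]dotC !dotBl// (dotC (f_ m)).
rewrite !dot_f.
have h k : (N <= k)%N -> b k - inf (range b) <= e / 2.
  by move=> /NP /=; rewrite distrC => /(le_trans (ler_norm _)).
have h1 := h (n + n).+1 (leqW (leq_trans Nn (leq_addr _ _))).
have h2 := h (m + m).+1 (leqW (leq_trans Nm (leq_addr _ _))).
have := b_inf (n + m).+1; move: h1 h2; lra.
Qed.

Let f_conv1 n : conv (f_ n) (cpow 1) = (fun x => mu * f_ n.+1 x).
Proof.
rewrite convZl// conv_cpow; apply/funext => x; rewrite /f_.
have -> : ((n + n).+1 + 1).+1 = (n.+1 + n.+1).+1 by rewrite !(addnS, addSn) addn0.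
by rewrite [mu ^+ n.+2]exprS invfM !mulrA mulfV ?mul1r// gt_eqF.
Qed.

(** One more convolution with [cpow 1] turns closeness in mean square into uniform closeness, by
    [conv_bound]. *)
Let f_unif e : 0 < e -> exists N, forall n m x, (N <= n)%N -> (N <= m)%N ->
  `|f_ n x - f_ m x| <= e.
Proof.
move=> e0.
have d0 : 0 < (mu * e) ^+ 2 / q 1%N by rewrite divr_gt0// exprn_gt0// mulr_gt0.
have [N NP] := f_cauchy d0; exists N.+1 => -[//|n] [//|m] x; rewrite !ltnS => Nn Nm.
rewrite -(@ler_pM2l _ mu)// -[X in X * `|_|](ger0_norm (ltW mu_gt0)) -normrM.
rewrite mulrBr -ler_sqr ?nnegrE ?normr_ge0 ?(ltW (mulr_gt0 mu_gt0 e0))//.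
rewrite real_normK ?num_real//.
have -> : mu * f_ n.+1 x - mu * f_ m.+1 x =
    conv (fun x => f_ n x - f_ m x) (cpow 1) x.
  by rewrite convBl// !f_conv1.
apply: le_trans (conv_bound _ (@f_subr_cont _ _) (@cpow_cont _)) _.
by rewrite -(ler_pdivlMr _ _ (q_gt0 1)); exact: NP.
Qed.

(** The uniform limit of the [f_ n] inherits symmetry and the eigenvalue equation; the lower bound
    at the identity comes from [b_ge1] and keeps the limit from vanishing. *)
Lemma top_eigenprojection : exists (mu : R) (f : G -> R),
  [/\ 0 < mu, continuous f, vee f = f, conv f f = f & 1 <= f 1%g] /\
  conv f (conv sigma sigma) = (fun x => mu * f x).
Proof.
have [f cf fP] := uniform_limit (@f_cont) f_unif; exists mu, f.
have lim_eq (x y : R) : (forall e, 0 < e -> `|x - y| <= e) -> x = y.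
  move=> h; apply/eqP; rewrite -subr_eq0 -normr_le0.
  by apply/ler_addgt0Pl => e e0; rewrite addr0 h.
have conv_lim h y e : continuous h -> 0 < e ->
    exists N, forall n, (N <= n)%N -> `|conv (f_ n) h y - conv f h y| <= e.
  move=> ch e0.
  have [B hB] := continuous_bounded (@compact_group_compact G) ch.
  have B0 : 0 <= B by apply: le_trans (hB 1%g).
  have d0 : 0 < e / (B + 1) by rewrite divr_gt0// ltr_wpDl.
  have [N NP] := fP _ d0; exists N => n Nn.
  have -> : conv (f_ n) h y - conv f h y = conv (fun x => f_ n x - f x) h y.
    by rewrite convBl.
  apply: le_trans (conv_bound_sup (e := e / (B + 1)) (B := B) y _ ch _ hB) _.
  - by cont.
  - by move=> x; exact: NP.
  - by rewrite -mulrA ler_piMr ?ltW// mulrC ltr_pdivrMr ?mul1r ?ltrDl ?ltr_wpDl.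
have f_sig : conv f (cpow 1) = (fun x => mu * f x).
  apply/funext => y; apply: lim_eq => e e0.
  have e20 : 0 < e / 2 by rewrite divr_gt0.
  have [N NP] := conv_lim (cpow 1) y _ (@cpow_cont _) e20.
  have [M MP] := fP (e / 2 / mu) (divr_gt0 e20 mu_gt0).
  have := NP (maxn N M) (leq_maxl _ _); rewrite f_conv1.
  have := MP (maxn N M).+1 y (leqW (leq_maxr _ _)).
  rewrite ler_pdivlMr// -{1}(ger0_norm (ltW mu_gt0)) -normrM mulrBl.
  by rewrite !ler_norml; lra.
have vf : vee f = f.
  apply/funext => x; apply: lim_eq => e e0.
  have e20 : 0 < e / 2 by rewrite divr_gt0.
  have [M MP] := fP _ e20.
  have := MP M x (leqnn _); have := MP M x^-1%g (leqnn _).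
  have <- : f_ M x = f_ M x^-1%g by rewrite /f_ -[in LHS]vee_cpow.
  by rewrite /vee !ler_norml; lra.
(* Being an eigenfunction, [f] is fixed by every normalised power; letting [n] grow gives
   idempotence. *)
have sig_f n : conv (f_ n) f = f.
  elim: n => [|n ih].
    have sf : conv (cpow 1) f = (fun x => mu * f x).
      by rewrite -{1}vf -(vee_cpow 1) -vee_conv// f_sig -{2}vf.
    rewrite convZl// sf; apply/funext => x.
    by rewrite expr1 mulrA mulVf ?mul1r// gt_eqF.
  have sf : conv (cpow 1) f = (fun x => mu * f x).
    by rewrite -{1}vf -(vee_cpow 1) -vee_conv// f_sig -{2}vf.
  have -> : f_ n.+1 = fun x => mu^-1 * conv (f_ n) (cpow 1) x.
    by apply/funext => x; rewrite f_conv1 mulrA mulVf ?mul1r// gt_eqF.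
  rewrite convZl//; last by auto.
  rewrite convA// sf convZr// ih; apply/funext => x.
  by rewrite mulrA mulVf ?mul1r// gt_eqF.
split; [split=> //|exact: f_sig].
- apply/funext => y; apply: lim_eq => e e0.
  have [N NP] := conv_lim f y e cf e0.
  by have := NP N (leqnn N); rewrite sig_f distrC.
- apply/ler_addgt0Pl => e e0; have [N NP] := fP _ e0.
  have := NP N 1%g (leqnn N).
  have -> : f_ N 1%g = b N by rewrite /f_ -dot_cpow /b mulrC.
  by rewrite ler_distl; have := b_ge1 N; lra.
Qed.

End TopEigenprojection.

(** * Finite-dimensional translation-invariant spaces of functions *)

Section PeterWeyl.
Variables (R : realType) (G : compactGroupType).
Implicit Types (f g v w : G -> R) (a x y : G).

Definition orthonormal n (e : 'I_n -> G -> R) :=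
  forall i j, dot (e i) (e j) = (i == j)%:R.

Let fixed f v := continuous v /\ conv v f = v.

(** Each [e i x] is the inner product of [e i] with [ltrans x f], so Bessel's inequality bounds the
    sum of the [e i x ^+ 2] by [dot f f]; taking the mean over [x] counts the family. *)
Lemma fixed_family_size f n (e : 'I_n -> G -> R) :
  continuous f -> vee f = f -> (forall i, fixed f (e i)) -> orthonormal e ->
  n%:R <= dot f f.
Proof.
move=> cf vf ef one.
have ce i : continuous (e i) := (ef i).1.
have bessel x : \sum_(i < n) e i x ^+ 2 <= dot f f.
  pose k := ltrans x f; have ck : continuous k by rewrite /k; auto.
  have kE i : dot (e i) k = e i x by rewrite -[in RHS](ef i).2 convE vf.
  pose p y := \sum_(i < n) e i x * e i y.
  have cp : continuous p by rewrite /p; cont.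
  have cd : continuous (fun y => k y - p y) by cont.
  have pk : dot p k = \sum_(i < n) e i x ^+ 2.
    by rewrite dot_suml//; apply: eq_bigr => i _; rewrite kE.
  have pp : dot p p = \sum_(i < n) e i x ^+ 2.
    rewrite {1}/p dot_suml//; apply: eq_bigr => i _.
    rewrite dotC dot_suml// (bigD1 i)//= one eqxx mulr1 big1 ?addr0 ?expr2//.
    by move=> j ji; rewrite one (negbTE ji) mulr0.
  have := dot_ge0 cd; rewrite dotBl// [dot k _]dotC [dot p _]dotC !dotBl//.
  by rewrite (dotC k p) pk pp -(@dot_ltrans _ _ x f f)// -/k; lra.
have : mean (fun x => \sum_(i < n) e i x ^+ 2) <= dot f f.
  rewrite -[leRHS](@mean_cst R G); apply: mean_le => //; last exact: cst_cont.
  by apply: sum_cont => i; have := ce i; under eq_fun do rewrite expr2; cont.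
rewrite mean_sum; last by move=> i; have := ce i; under eq_fun do rewrite expr2; cont.
rewrite (eq_bigr (fun=> 1)) ?sumr_const ?card_ord// => i _.
by have := one i i; rewrite eqxx /dot; under eq_fun do rewrite -expr2.
Qed.

(** The size bound provides an orthonormal family of maximal size; a nonzero remainder of some fixed
    [v] could be normalised and added to it. *)
Lemma fixed_family_max f : continuous f -> vee f = f ->
  exists n (e : 'I_n -> G -> R), [/\ forall i, fixed f (e i), orthonormal e &
    forall v, fixed f v -> v = (fun x => \sum_(i < n) dot v (e i) * e i x)].
Proof.
move=> cf vf.
pose P n := `[< exists e : 'I_n -> G -> R, (forall i, fixed f (e i)) /\ orthonormal e >].
have P0 : exists n, P n by exists 0%N; apply/asboolP; exists (fun _ _ => 0); split=> -[].
have Pub n : P n -> (n <= Num.bound (dot f f))%N.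
  move=> /asboolP [e [ef one]]; rewrite -(ler_nat R).
  apply: le_trans (fixed_family_size cf vf ef one) _.
  by apply: ltW; rewrite archi_boundP// dot_ge0.
case: (ex_maxnP P0 Pub) => n /asboolP [e [ef one]] nmax.
exists n, e; split=> // v [cv vfix].
have ce i : continuous (e i) := (ef i).1.
have fixedE u y : conv u f = u -> u y = dot u (ltrans y f).
  by move=> uf; rewrite -{1}uf convE vf.
pose w x := v x - \sum_(i < n) dot v (e i) * e i x.
have cs : continuous (fun x => \sum_(i < n) dot v (e i) * e i x) by cont.
have cw : continuous w by rewrite /w; cont.
have wf : conv w f = w.
  apply/funext => y; rewrite convE dotBl// ?vf; [|by auto].
  rewrite dot_suml//; last by auto.
  by rewrite /w (fixedE v _ vfix); under [in RHS]eq_bigr do rewrite (fixedE (e _) _ (ef _).2).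
have we i : dot w (e i) = 0.
  rewrite dotBl// dot_suml// (bigD1 i)//= one eqxx mulr1 big1 ?addr0 ?subrr//.
  by move=> j ji; rewrite one (negbTE ji) mulr0.
apply/funext => x; apply/eqP; rewrite -subr_eq0; apply/negP => /negP wx.
have ww : 0 < dot w w by exact: (dot_gt0 (x := x)).
pose c := (Num.sqrt (dot w w))^-1.
have cc : c * (c * dot w w) = 1.
  rewrite mulrA -expr2 /c exprVn sqr_sqrtr ?ltW// mulVf// gt_eqF//.
pose w1 y := c * w y.
have cw1 : continuous w1 by rewrite /w1; cont.
suff : P n.+1 by move=> /nmax; rewrite ltnn.
apply/asboolP.
exists (fun i => if unlift ord_max i is Some j then e j else w1); split=> [i|i j].
  case: unliftP => [j _|_]; first exact: ef.
  by split=> //; rewrite /w1 convZl// wf.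
have w1e k : dot w1 (e k) = 0 by rewrite dotZl// we mulr0.
case: (unliftP ord_max i) => [i' ->|->]; case: (unliftP ord_max j) => [j' ->|->].
- by rewrite one (inj_eq lift_inj).
- by rewrite dotC w1e [_ == _]eq_sym (negbTE (neq_lift _ _)).
- by rewrite w1e (negbTE (neq_lift _ _)).
- by rewrite eqxx dotZl// dotC dotZl.
Qed.

(** The span is the range of right convolution by the top eigenprojection [f] of [conv (vee D) D],
    which left translations preserve because they commute with right convolution. If [D] were
    orthogonal to it, [conv D f] would vanish, against the positive eigenvalue. *)
Lemma peter_weyl (D : G -> R) (x : G) : continuous D -> D x != 0 ->
  exists n (e : 'I_n -> G -> R), [/\ forall i, continuous (e i), orthonormal e,
    forall a i, ltrans a (e i) =
      (fun x => \sum_(j < n) dot (ltrans a (e i)) (e j) * e j x) &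
    exists i, dot D (e i) != 0].
Proof.
move=> cD Dx; pose s := conv (vee D) D.
have cs : continuous s by rewrite /s; auto.
have vs : vee s = s by rewrite /s vee_conv ?veeK//; auto.
have s1 : s 1%g != 0 by rewrite /s -dot_convV// gt_eqF// (dot_gt0 (x := x)).
have [mu [f [[mu0 cf vf ff f1] fs]]] := top_eigenprojection cs vs s1.
have [n [e [ef one espan]]] := fixed_family_max cf vf.
have ce i : continuous (e i) := (ef i).1.
exists n, e; split=> // [a i|].
  apply: espan; split; first by auto.
  by rewrite -ltrans_conv// (ef i).2.
apply: contrapT => /forallNP De.
have {}De i : dot D (e i) = 0 by apply/eqP; have /negP := De i; rewrite negbK.
have Df : conv D f = (fun=> 0).
  apply/funext => y; rewrite convE vf dotC (espan (ltrans y f)).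
    rewrite dot_suml// big1// => i _.
    by rewrite (dotC (e i)) De mulr0.
  by split; [auto|rewrite -ltrans_conv// ff].
have conv0 h : conv h (fun=> 0) = (fun=> 0).
  by apply/funext => y; rewrite convE dotC (_ : ltrans _ _ = fun=> 0)// dot0l.
have ssf : conv (conv s s) f = (fun=> 0).
  rewrite convA// {2}/s convA//; last by auto.
  by rewrite Df !conv0.
(* [vee] moves [f] to the other side, where the convolution vanishes, whereas the eigenvalue
   equation gives [mu * f 1]. *)
have : vee (conv f (conv s s)) 1%g = 0.
  by rewrite vee_conv ?vf//; [rewrite vee_conv// vs ssf|auto].
rewrite fs /vee invg1 => /eqP; rewrite mulf_eq0 !gt_eqF//.
exact: lt_le_trans ltr01 f1.
Qed.

End PeterWeyl.

(** * Orthogonal representations *)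

Section Representations.
Variable R : realType.

(** Arbitrary finite index types let sums, products and options of types carry direct sums, tensor
    products and an added line. The last clause expresses orthogonality. *)
Definition orep (G : compactGroupType) (J : finType) (rho : G -> J -> J -> R) :=
  [/\ forall i j, continuous (fun g => rho g i j),
      forall i j, rho 1%g i j = (i == j)%:R,
      forall g h i k, rho (g * h)%g i k = \sum_j rho g i j * rho h j k &
      forall g i j, rho g^-1%g i j = rho g j i].

Lemma sum_delta (J : finType) (i : J) (f : J -> R) :
  \sum_j (i == j)%:R * f j = f i.
Proof.
rewrite (bigD1 i)//= eqxx mul1r big1 ?addr0// => j ji.
by rewrite eq_sym (negbTE ji) mul0r.
Qed.

Lemma sum_deltar (J : finType) (i : J) (f : J -> R) :
  \sum_j f j * (j == i)%:R = f i.
Proof.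
rewrite (bigD1 i)//= eqxx mulr1 big1 ?addr0// => j ji.
by rewrite (negbTE ji) mulr0.
Qed.

Lemma orep_trivial (G : compactGroupType) (J : finType) :
  orep (fun (_ : G) (i j : J) => (i == j)%:R).
Proof.
split=> //; first by move=> i j; exact: cst_cont.
  by move=> _ _ i k; rewrite sum_delta.
by move=> _ i j; rewrite eq_sym.
Qed.

Lemma compact_homV (G K : compactGroupType) (f : G -> K) : compact_hom f ->
  forall g, f g^-1%g = (f g)^-1%g.
Proof. by move=> [[f1 fM] _] g; apply/esym/mulg1_eq; rewrite -fM mulgV f1. Qed.

Lemma orep_comp (G K : compactGroupType) (J : finType) (f : G -> K)
    (rho : K -> J -> J -> R) :
  compact_hom f -> orep rho -> orep (fun g => rho (f g)).
Proof.
move=> fh [c r1 rM rV]; have fV := compact_homV fh.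
have [[f1 fM] cf] := fh; split=> [i j|i j|g h i k|g i j].
- exact: (comp_cont cf (c i j)).
- by rewrite f1.
- by rewrite fM.
- by rewrite fV.
Qed.

(** The vanishing entries cut the product sum down to the image of [phi]. This covers both
    reindexing along a bijection and restriction to an invariant block. *)
Lemma orep_inj (G : compactGroupType) (J J' : finType) (phi : J' -> J)
    (rho : G -> J -> J -> R) :
  injective phi ->
  (forall g i j, i \in codom phi -> j \notin codom phi -> rho g i j = 0) ->
  orep rho -> orep (fun g i j => rho g (phi i) (phi j)).
Proof.
move=> phi_inj z [c r1 rM rV]; split=> [i j|i j|g h i k|g i j].
- exact: c.
- by rewrite r1 (inj_eq phi_inj).
- rewrite rM (bigID (mem (codom phi)))/= [X in _ + X]big1 ?addr0 => [|j jphi].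
    rewrite -big_uniq; last by rewrite map_inj_uniq// enum_uniq.
    by rewrite big_image.
  by rewrite z ?codom_f// mul0r.
- by rewrite rV.
Qed.

Definition dsum (G : Type) (J1 J2 : finType) (rho1 : G -> J1 -> J1 -> R)
    (rho2 : G -> J2 -> J2 -> R) g (i j : J1 + J2) : R :=
  match i, j with
  | inl i, inl j => rho1 g i j
  | inr i, inr j => rho2 g i j
  | _, _ => 0
  end.

Lemma orep_dsum (G : compactGroupType) (J1 J2 : finType)
    (rho1 : G -> J1 -> J1 -> R) (rho2 : G -> J2 -> J2 -> R) :
  orep rho1 -> orep rho2 -> orep (dsum rho1 rho2).
Proof.
move=> [c1 r11 rM1 rV1] [c2 r12 rM2 rV2]; split.
- by move=> [i|i] [j|j] /=; [exact: c1|exact: cst_cont|exact: cst_cont|exact: c2].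
- by move=> [i|i] [j|j] /=; rewrite ?r11 ?r12.
- move=> g h [i|i] [j|j]; rewrite big_sumType /= ?rM1 ?rM2.
  + by rewrite [X in _ + X]big1 ?addr0// => k _; rewrite mul0r.
  + by rewrite !big1 ?addr0// => k _; rewrite ?mul0r ?mulr0.
  + by rewrite !big1 ?addr0// => k _; rewrite ?mul0r ?mulr0.
  + by rewrite [X in X + _]big1 ?add0r// => k _; rewrite mul0r.
- by move=> g [i|i] [j|j] /=.
Qed.

Definition tensor (G : Type) (J1 J2 : finType) (rho1 : G -> J1 -> J1 -> R)
    (rho2 : G -> J2 -> J2 -> R) g (i j : J1 * J2) : R :=
  rho1 g i.1 j.1 * rho2 g i.2 j.2.

Lemma orep_tensor (G : compactGroupType) (J1 J2 : finType)
    (rho1 : G -> J1 -> J1 -> R) (rho2 : G -> J2 -> J2 -> R) :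
  orep rho1 -> orep rho2 -> orep (tensor rho1 rho2).
Proof.
move=> [c1 r11 rM1 rV1] [c2 r12 rM2 rV2]; rewrite /tensor; split.
- by move=> i j; apply: mulr_cont; [exact: c1|exact: c2].
- by move=> [i i'] [j j'] /=; rewrite r11 r12 -natrM mulnb.
- move=> g h i k; rewrite rM1 rM2 big_distrlr/= pair_bigA/=.
  by apply: eq_bigr => -[j j'] _ /=; ring.
- by move=> g i j; rewrite rV1 rV2.
Qed.

Lemma orep_conj (G : compactGroupType) (J : finType) (Q : J -> J -> R)
    (rho : G -> J -> J -> R) :
  (forall i j, Q i j = Q j i) ->
  (forall i k, \sum_j Q i j * Q j k = (i == k)%:R) ->
  orep rho -> orep (fun g i l => \sum_j \sum_k Q i j * rho g j k * Q k l).
Proof.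
move=> Qs QQ [c r1 rM rV]; split.
- move=> i l; apply: sum_cont => j; apply: sum_cont => k.
  by have cjk := c j k; cont.
- move=> i l; rewrite -QQ; apply: eq_bigr => j _.
  under eq_bigr do rewrite r1 -mulrA; rewrite -mulr_sumr; congr (_ * _).
  by rewrite sum_delta.
- move=> g h i l.
  (* The Kronecker delta inserted in the middle will be expanded as the square of [Q], splitting the
     product into two conjugates. *)
  transitivity (\sum_j \sum_k Q i j * (\sum_m \sum_m' rho g j m * (m == m')%:R * rho h m' k) * Q k l).
    apply: eq_bigr => j _; apply: eq_bigr => k _; rewrite rM; congr (_ * _ * _).
    apply: eq_bigr => m _; under eq_bigr do rewrite -mulrA.
    by rewrite -mulr_sumr sum_delta.
  transitivity (\sum_j \sum_k \sum_m \sum_m' \sum_n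
     Q i j * rho g j m * Q m n * (Q n m' * rho h m' k * Q k l)).
    apply: eq_bigr => j _; apply: eq_bigr => k _.
    rewrite mulr_sumr mulr_suml; apply: eq_bigr => m _.
    rewrite mulr_sumr mulr_suml; apply: eq_bigr => m' _.
    rewrite -QQ mulr_sumr mulr_suml mulr_sumr mulr_suml; apply: eq_bigr => n _.
    by ring.
  under [RHS]eq_bigr => n _.
    rewrite mulr_suml.
    under eq_bigr => j _.
      rewrite mulr_suml.
      under eq_bigr => m _.
        rewrite mulr_sumr.
        under eq_bigr => m' _ do rewrite mulr_sumr.
        over.
      over.
    over.
  symmetry; rewrite exchange_big /=; apply: eq_bigr => j _.
  under [RHS]eq_bigr => k _ do under eq_bigr => m _ do rewrite exchange_big/=.
  under [RHS]eq_bigr => k _ do rewrite exchange_big/=.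
  rewrite [RHS]exchange_big /=; apply: eq_bigr => n _.
  rewrite [RHS]exchange_big /=; apply: eq_bigr => m _.
  by rewrite [RHS]exchange_big.
- move=> g i l; rewrite exchange_big; apply: eq_bigr => k _; apply: eq_bigr => j _.
  by rewrite rV (Qs i) (Qs k l); ring.
Qed.

End Representations.

(** * Representations of split extensions *)

Section SplitRepresentations.
Variable R : realType.

(** Compact Hausdorff spaces are normal, so Urysohn's lemma applies to the two closed points. *)
Lemma separating_function (G : compactGroupType) (x y : G) : x != y ->
  exists2 f : G -> R, continuous f & f x != f y.
Proof.
move=> xy.
have hG : hausdorff_space G := @compact_group_hausdorff G.
have nG : normal_space G by apply: compact_normal => //; exact: compact_group_compact.
have cl1 (z : G) : closed [set z].
  by apply: accessible_closed_set1; exact: hausdorff_accessible.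
have dj : [set x] `&` [set y] = set0.
  by apply/disjoints_subset => z -> /= yx; move: xy; rewrite yx eqxx.
have /(@uniform_separatorP _ R)[f [cf _ f0 f1]] :=
  (@normal_separatorP R G).1 nG _ _ (cl1 x) (cl1 y) dj.
exists f => //.
have -> : f x = 0 by apply: f0; exists x.
have -> : f y = 1 by apply: f1; exists y.
by rewrite eq_sym oner_eq0.
Qed.

(** Peter-Weyl is applied to the difference between an [H]-invariant function and its translate by
    [x]; the coordinates of the invariant function form [u]. *)
Lemma separating_orep (G H : compactGroupType) (iota : H -> G) (r : G -> H) (x : G) :
  compact_hom iota -> compact_hom r -> cancel iota r -> r x = 1%g -> x != 1%g ->
  exists n (rho : G -> 'I_n -> 'I_n -> R) (u : 'I_n -> R),
    [/\ orep rho, forall h i, \sum_j rho (iota h) i j * u j = u i &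
      exists i, \sum_j rho x i j * u j != u i].
Proof.
move=> hi hr ri rx x1.
have [eta ceta eta1] : exists2 f : G -> R, continuous f & f x^-1%g != f 1%g.
  by apply: separating_function; rewrite invg_eq1.
(* Twisting by the retraction makes [psi] invariant under left translation by the image of [iota];
   since [r x = 1], it still separates [x^-1] from the identity. *)
pose psi y := eta ((iota (r y))^-1 * y)%g.
have [[i1 iM] ci] := hi; have [[r1 rM] cr] := hr.
have cpsi : continuous psi by rewrite /psi; cont.
have psiH h : ltrans (iota h) psi = psi.
  apply/funext => y; rewrite /ltrans /psi rM iM -(compact_homV hi) ri.
  by congr eta; rewrite invgM -!mulgA mulKg.
pose D y := ltrans x psi y - psi y.
have cD : continuous D by rewrite /D /ltrans; cont.
have D1 : D 1%g != 0.
  rewrite /D /ltrans mulg1 /psi r1 i1 invg1 !mul1g (compact_homV hr) rx invg1 i1.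
  by rewrite invg1 mul1g subr_eq0.
have [n [e [ce one espan [k De]]]] := peter_weyl cD D1.
pose rho g (i j : 'I_n) := dot (ltrans g (e j)) (e i).
have rhoV g i j : rho g^-1%g i j = rho g j i.
  by rewrite /rho dot_ltransV// invgK dotC.
(* [psi] may lie outside the span of the [e j], but orthogonal projection onto this invariant span
   commutes with translations. *)
have rho_u g i : \sum_j rho g i j * dot psi (e j) = dot (ltrans g psi) (e i).
  rewrite dot_ltransV// dotC espan dot_suml//.
  by apply: eq_bigr => j _; rewrite -/(rho g^-1%g j i) rhoV dotC.
exists n, rho, (fun j => dot psi (e j)); split.
- split=> // [i j|i j|g h i k'].
  + apply: (@mean_cont _ _ _ (fun w => ltrans w.1 (e j) w.2 * e i w.2)).
    by have ci1 := ce i; have cj := ce j; rewrite /ltrans; cont.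
  + by rewrite /rho ltrans1 one eq_sym.
  + rewrite /rho ltransM [in LHS]espan.
    have -> : ltrans g (fun x0 => \sum_(j < n) dot (ltrans h (e k')) (e j) * e j x0) =
       (fun x0 => \sum_(j < n) dot (ltrans h (e k')) (e j) * ltrans g (e j) x0) by [].
    rewrite dot_suml//; last by move=> j; exact: ltrans_cont.
    by apply: eq_bigr => j _; rewrite mulrC.
- by move=> h i; rewrite rho_u psiH.
- exists k; rewrite rho_u -subr_eq0 -dotBl//.
  by auto.
Qed.

Lemma sum_option (J : finType) (F : option J -> R) :
  \sum_p F p = F None + \sum_j F (Some j).
Proof.
rewrite (bigD1 None)//=; congr (_ + _).
rewrite (reindex_omap Some id); last by case.
by apply: eq_bigl => j; rewrite /= eqxx.
Qed.

(** * Mixing a vector with a trivial line by a reflection *)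

Section Householder.
Variables (J : finType) (u : J -> R).

(** The coordinate of the normal vector [w] on the added line. It is positive and its square exceeds
    the squared norm of [u], which makes the entry [Q None None] nonzero. *)
Let alpha : R := 1 + \sum_j u j ^+ 2.
Let w (p : option J) : R := if p is Some j then u j else alpha.
Let c : R := 2 / \sum_p w p ^+ 2.
Let Q p q : R := (p == q)%:R - c * w p * w q.

Let alpha_gt0 : 0 < alpha.
Proof. by rewrite ltr_pwDl// sumr_ge0// => j _; exact: sqr_ge0. Qed.

Let norm_w : \sum_p w p ^+ 2 = alpha ^+ 2 + \sum_j u j ^+ 2.
Proof. by rewrite sum_option. Qed.

Let norm_gt0 : 0 < \sum_p w p ^+ 2.
Proof.
by rewrite norm_w ltr_pwDl ?exprn_gt0// sumr_ge0// => j _; exact: sqr_ge0.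
Qed.

Let Q_sym p q : Q p q = Q q p.
Proof. by rewrite /Q eq_sym; ring. Qed.

Let Q_app p (v : option J -> R) :
  \sum_q Q p q * v q = v p - c * w p * \sum_q w q * v q.
Proof.
rewrite mulr_sumr; under eq_bigr do rewrite mulrBl.
by rewrite sumrB sum_delta; under [in RHS]eq_bigr do rewrite mulrA.
Qed.

Let QQ p q : \sum_k Q p k * Q k q = (p == q)%:R.
Proof.
rewrite Q_app.
(* The reflection negates its normal vector. *)
have -> : \sum_k w k * Q k q = - w q.
  under eq_bigr do rewrite mulrC Q_sym; rewrite Q_app.
  have -> : \sum_q0 w q0 * w q0 = \sum_p0 w p0 ^+ 2 by [].
  by rewrite /c; field; rewrite gt_eqF.
by rewrite /Q; ring.
Qed.

(** [rho'] is the conjugate by [Q] of a trivial line plus [rho]. An element fixing [u] fixes [w],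
    hence commutes with [Q]. If column [None] of [rho' g] vanished off the diagonal, the image under
    [Q] of the added basis vector would be an eigenvector, forcing [rho g] to fix [u]. *)
Lemma householder_mix (G : compactGroupType) (rho : G -> J -> J -> R) :
  orep rho -> exists rho' : G -> option J -> option J -> R,
  [/\ orep rho',
    forall g, (forall i, \sum_j rho g i j * u j = u i) ->
      forall p q, rho' g p q =
        match p, q with
        | None, None => 1 | Some i, Some j => rho g i j | _, _ => 0
        end &
    forall g, (exists i, \sum_j rho g i j * u j != u i) ->
      exists i, rho' g (Some i) None != 0].
Proof.
move=> orho; have [cr r1 rM rV] := orho.
pose rho0 (g : G) (p q : option J) : R :=
  match p, q with
  | None, None => 1 | Some i, Some j => rho g i j | _, _ => 0
  end.
have orho0 : orep rho0.
  split.
  - move=> [i|] [j|]; [exact: cr|exact: cst_cont|exact: cst_cont|exact: cst_cont].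
  - by move=> [i|] [j|] //=; exact: r1.
  - move=> g h [i|] [j|]; rewrite sum_option /= ?mul0r ?mul1r ?add0r ?rM//.
    + by rewrite big1// => k _; rewrite mulr0.
    + by rewrite big1// => k _; rewrite mul0r.
    + by rewrite big1 ?addr0// => k _; rewrite mul0r.
  - by move=> g [i|] [j|] //=; exact: rV.
pose rho' g p q := \sum_k \sum_l Q p k * rho0 g k l * Q l q.
exists rho'; split; first exact: orep_conj.
- move=> g gu p q.
  have rw k : \sum_l rho0 g k l * w l = w k.
    case: k => [k|]; rewrite sum_option /= ?mul0r ?add0r ?gu// mul1r big1 ?addr0//.
    by move=> j _; rewrite mul0r.
  (* Orthogonality turns a fixed column vector into a fixed row vector. *)
  have rVw l : \sum_k w k * rho0 g k l = w l.
    have [c0 r01 r0M r0V] := orho0.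
    transitivity (\sum_k rho0 g^-1%g l k * w k).
      by apply: eq_bigr => k _; rewrite r0V mulrC.
    transitivity (\sum_k rho0 g^-1%g l k * \sum_m rho0 g k m * w m).
      by apply: eq_bigr => k _; rewrite rw.
    under eq_bigr do rewrite mulr_sumr.
    rewrite exchange_big /=.
    under eq_bigr => m _.
      under eq_bigr do rewrite mulrA.
      rewrite -mulr_suml -r0M mulVg r01.
      over.
    by rewrite sum_delta.
  have Qr k q' : \sum_l Q k l * rho0 g l q' = \sum_l rho0 g k l * Q l q'.
    rewrite Q_app rVw.
    under eq_bigr do rewrite mulrC Q_sym.
    rewrite Q_app; congr (_ - _).
    under [in RHS]eq_bigr do rewrite mulrC.
    by rewrite rw; ring.
  transitivity (\sum_l (\sum_k rho0 g p k * Q k l) * Q l q).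
    rewrite /rho' exchange_big; apply: eq_bigr => l _.
    by rewrite -mulr_suml Qr.
  transitivity (\sum_k rho0 g p k * \sum_l Q k l * Q l q).
    under eq_bigr do rewrite mulr_suml.
    rewrite exchange_big; apply: eq_bigr => k _; rewrite mulr_sumr.
    by apply: eq_bigr => l _; rewrite mulrA.
  by under eq_bigr do rewrite QQ; rewrite sum_deltar.
- move=> g [i gi]; apply: contrapT => /forallNP nz.
  have {}nz j : rho' g (Some j) None = 0.
    by apply/eqP; have /negP := nz j; rewrite negbK.
  pose y p := Q p None.
  pose t := rho' g None None.
  have ry p : \sum_q rho0 g p q * y q = t * y p.
    transitivity (\sum_k Q p k * rho' g k None).
      transitivity (\sum_a (\sum_k Q p k * Q k a) * \sum_l rho0 g a l * Q l None).
        by under [RHS]eq_bigr do rewrite QQ; rewrite sum_delta.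
      under eq_bigr do rewrite mulr_suml.
      rewrite exchange_big; apply: eq_bigr => k _; rewrite mulr_sumr.
      apply: eq_bigr => a _; rewrite -mulrA mulr_sumr; congr (_ * _).
      by apply: eq_bigr => l _; rewrite mulrA.
    rewrite sum_option/= big1 ?addr0; last by move=> j _; rewrite nz mulr0.
    by rewrite mulrC.
  have y0 : y None != 0.
    apply/eqP; rewrite /y /Q eqxx /= => h.
    have s0 : 0 <= \sum_j u j ^+ 2 by apply: sumr_ge0 => j _; exact: sqr_ge0.
    have c0 : 0 < c by rewrite /c divr_gt0.
    have : c * (alpha ^+ 2 + \sum_j u j ^+ 2) = 2.
      by rewrite -norm_w /c mulfVK// gt_eqF.
    move: h c0 s0; rewrite /alpha; set s := \sum_j _; nra.
  (* The action on the trivial line is the identity and [y] has a nonzero coordinate there, which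
     determines the eigenvalue. *)
  have t1 : t = 1.
    have := ry None; rewrite sum_option/= big1 ?addr0 ?mul1r.
      by move/(congr1 (fun z => z / y None)); rewrite divff// mulfK.
    by move=> j _; rewrite mul0r.
  have ySome j : y (Some j) = - (c * alpha) * u j by rewrite /y /Q /=; ring.
  have := ry (Some i); rewrite sum_option/= mul0r add0r t1 mul1r.
  under eq_bigr do rewrite ySome mulrCA.
  rewrite -mulr_sumr ySome => /mulfI h; move: gi; rewrite h ?eqxx//.
  by rewrite oppr_eq0 mulf_neq0// gt_eqF// divr_gt0.
Qed.

End Householder.
End SplitRepresentations.

(** * Towers of representations along a reduced word *)

(** Recording the prescribed value as a transport along every proof of [i1 = i] allows one choice
    for all indices at once. *)
Lemma choice_at (I : Type) (T : I -> Type) (P : forall i, T i -> Prop)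
    (i1 : I) (t1 : T i1) :
  P i1 t1 -> (forall i, i <> i1 -> exists t, P i t) ->
  exists f : forall i, T i, (forall i, P i (f i)) /\ f i1 = t1.
Proof.
move=> P1 Pn.
have h i : exists t, P i t /\ forall e : i1 = i, t = eq_rect i1 T t1 i e.
  case: (pselect (i1 = i)) => [e|ne].
    case: i / e; exists t1; split=> // e.
    by rewrite (Prop_irrelevance e erefl).
  have [|t Pt] := Pn i; first by move=> e; apply: ne.
  by exists t; split.
exists (fun i => projT1 (cid (h i))); split=> [i|].
  by case: (projT2 (cid (h i))).
by case: (projT2 (cid (h i1))) => _ /(_ erefl).
Qed.

Section Towers.
Variables (R : realType) (I : Type) (H : compactGroupType).
Variables (G : I -> compactGroupType) (iota : forall i, H -> G i).
Variable r : forall i, G i -> H.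
Hypotheses (iota_hom : forall i, compact_hom (iota i)).
Hypotheses (r_hom : forall i, compact_hom (@r i)).
Hypothesis (iotaK : forall i, cancel (iota i) (@r i)).

Local Notation letter := {i : I & G i}.

(** The head of a word acts first, so this is the condition for a letter of index [i] to act just
    before [w]. *)
Definition avoids (i : I) (w : seq letter) :=
  if w is l :: _ then i <> tag l else True.

(* A word lists its letters in the order in which they act: the word
   [:: x_1; ...; x_m] stands for the product [x_m ... x_1]. *)
Fixpoint reduced (w : seq letter) : Prop :=
  if w is l :: w' then
    [/\ r (tagged l) = 1%g, tagged l <> 1%g, avoids (tag l) w' & reduced w']
  else True.

Definition up (K : finType) (L : K -> nat) (M : K -> K -> R) (v : K -> R) p :=
  \sum_(q | L p == (L q).+1) M p q * v q.

Definition ascend (K : finType) (L : K -> nat) (Rr : forall i, G i -> K -> K -> R)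
    (w : seq letter) (v : K -> R) :=
  foldl (fun v l => up L (Rr (tag l) (tagged l)) v) v w.

Definition word_act (K : finType) (Rr : forall i, G i -> K -> K -> R)
    (w : seq letter) (v : K -> R) :=
  foldl (fun v l p => \sum_q Rr (tag l) (tagged l) p q * v q) v w.

(** Each letter raises the level by at most one, so level [n + size w] is reached only by climbing
    at every step, starting from level [n]; hence agreement of [u] and [u'] on that level
    suffices. *)
Lemma word_act_ascend (K : finType) (L : K -> nat)
    (Rr : forall i, G i -> K -> K -> R) :
  (forall i g p q, ((L q).+1 < L p)%N -> Rr i g p q = 0) ->
  forall w n u u', (forall p, (n < L p)%N -> u p = 0) ->
    (forall p, L p = n -> u p = u' p) ->
    forall p, L p = (n + size w)%N -> word_act Rr w u p = ascend L Rr w u' p.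
Proof.
move=> band; elim=> [|l w ih] n u u' u0 uu' p /=.
  by rewrite addn0 => /uu'.
rewrite addnS -addSn; apply: ih => {}p.
  move=> Lp; apply: big1 => q _.
  have [Lq|Lq] := ltnP n (L q); first by rewrite u0// mulr0.
  by rewrite band ?mul0r// (leq_trans _ Lp).
move=> Lp; rewrite /up (bigID (fun q => L p == (L q).+1))/= [X in _ + X]big1 ?addr0.
  by apply: eq_bigr => q; rewrite Lp eqSS => /eqP Lq; rewrite uu'.
move=> q; rewrite Lp eqSS => nq.
have [Lq|Lq] := ltnP n (L q); first by rewrite u0// mulr0.
by rewrite band ?mul0r// Lp ltnS ltn_neqAle Lq eq_sym nq.
Qed.

Definition ext0 (E J : finType) (v : E -> R) (p : E + J) : R :=
  if p is inl a then v a else 0.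

Definition level (E J : finType) (lev : J -> nat) (p : E + J) : nat :=
  if p is inr j then lev j else 0%N.

(* [F = E + J] with [E] at level 0; the letters of [w] successively climb the
   levels. The base [E] is left unmixed by the [G i] allowed below [w], so that a
   further letter can be inserted there. *)
Record tower (w : seq letter) (E J : finType) (tau : H -> E -> E -> R)
    (lev : J -> nat) (RH : H -> E + J -> E + J -> R)
    (Rr : forall i, G i -> E + J -> E + J -> R) : Prop := {
  tower_lev : forall j, (0 < lev j)%N;
  tower_repH : orep RH;
  tower_rep : forall i, orep (Rr i);
  tower_iota : forall i h p q, Rr i (iota i h) p q = RH h p q;
  tower_base : forall h a b, RH h (inl a) (inl b) = tau h a b;
  tower_base0 : forall h a j, RH h (inl a) (inr j) = 0;
  tower_avoid : forall i g a b, avoids i w ->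
    Rr i g (inl a) (inl b) = tau (r g) a b;
  tower_avoid0 : forall i g a j, avoids i w -> Rr i g (inl a) (inr j) = 0;
  tower_band : forall i g p q, ((level lev q).+1 < level lev p)%N ->
    Rr i g p q = 0;
  tower_ascend : forall v : E -> R, (exists a, v a != 0) ->
    exists p, level lev p = size w /\ ascend (level lev) Rr w (ext0 v) p != 0
}.

Lemma tower_nil (E : finType) (tau : H -> E -> E -> R) : orep tau ->
  exists (J : finType) (lev : J -> nat) RH Rr, tower [::] tau lev RH Rr.
Proof.
move=> otau; pose triv (G0 : compactGroupType) (_ : G0) (i j : void) : R :=
  (i == j)%:R.
exists void, (fun=> 1%N), (dsum tau (@triv H)).
exists (fun i => dsum (fun g => tau (@r i g)) (@triv (G i))).
split=> //.
- by apply: orep_dsum => //; exact: orep_trivial.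
- move=> i; apply: orep_dsum; last exact: orep_trivial.
  exact: (orep_comp (@r_hom i)).
- by move=> i h [a|[]] [b|[]] /=; rewrite iotaK.
- by move=> i g [a|[]] [b|[]].
- by move=> v [a va]; exists (inl a).
Qed.

Lemma orep_sym0 (G0 : compactGroupType) (J : finType) (rho : G0 -> J -> J -> R) i j :
  orep rho -> (forall g, rho g i j = 0) -> forall g, rho g j i = 0.
Proof. by move=> [_ _ _ rV] h g; rewrite -rV h. Qed.

(** * Adding a first letter to a tower *)

Section TowerStep.
Variables (i1 : I) (x1 : G i1) (w : seq letter).
Variables (E J0 : finType) (tau : H -> E -> E -> R).
Variables (rho : G i1 -> J0 -> J0 -> R).
Variables (rho' : G i1 -> option J0 -> option J0 -> R).
Hypotheses (tau_rep : orep tau) (rho'_rep : orep rho').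
Hypothesis rho'_iota : forall h p q, rho' (iota i1 h) p q =
  match p, q with
  | None, None => 1 | Some i, Some j => rho (iota i1 h) i j | _, _ => 0
  end.
Hypotheses (rx1 : r x1 = 1%g) (i1w : avoids i1 w).
Hypothesis rho'_x1 : exists k, rho' x1 (Some k) None != 0.

(** The base of the tail tower, [E] tensored with the space of [rho]; it becomes level 1 of the new
    tower. *)
Let E1 : finType := (E * J0)%type.
Let tau1 : H -> E1 -> E1 -> R := tensor tau (fun h => rho (iota i1 h)).

Variables (J1 : finType) (lev1 : J1 -> nat).
Variables (RH1 : H -> E1 + J1 -> E1 + J1 -> R).
Variables (R1 : forall i, G i -> E1 + J1 -> E1 + J1 -> R).
Hypothesis t1 : tower w tau1 lev1 RH1 R1.

Let J : finType := (E1 + J1)%type.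
Let lev (j : J) : nat := (level lev1 j).+1.
Let RH : H -> E + J -> E + J -> R := dsum tau RH1.

(** Regroups levels 0 and 1, as far as the latter comes from [E1], into [E] tensored with the space
    on which [rho'] acts. *)
Let phi (p : E + J) : (E * option J0) + J1 :=
  match p with
  | inl a => inl (a, None)
  | inr (inl (a, k)) => inl (a, Some k)
  | inr (inr j) => inr j
  end.

Let mixed (g : G i1) (p q : E + J) : R :=
  dsum (tensor (fun g => tau (r g)) rho') (fun g j k => R1 g (inr j) (inr k))
    g (phi p) (phi q).

(** The requirements at a single index, so that [choice_at] can assemble the family: [mixed] at
    [i1], a direct sum elsewhere. *)
Let good i (rr : G i -> E + J -> E + J -> R) : Prop :=
  [/\ orep rr, forall h p q, rr (iota i h) p q = RH h p q,
      i <> i1 -> forall g p q, rr g p q = dsum (fun g => tau (r g)) (@R1 i) g p q,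
      forall g p q, ((level lev q).+1 < level lev p)%N -> rr g p q = 0 &
      forall g p q, level lev1 p = (level lev1 q).+1 ->
        rr g (inr p) (inr q) = R1 g p q].

(** As [w] avoids [i1], the base of the tail tower splits off under [G i1], so the action there can
    be replaced by the mixing block without touching [J1]. *)
Let good_mixed : good mixed.
Proof.
have R1J g j a : R1 (i := i1) g (inr j) (inl a) = 0.
  apply: (orep_sym0 (tower_rep t1 i1)) => {}g.
  exact: (tower_avoid0 t1).
have RH1J h j a : RH1 h (inr j) (inl a) = 0.
  by apply: (orep_sym0 (tower_repH t1)) => {}h; exact: (tower_base0 t1).
split=> //.
- apply: orep_inj.
  + by move=> [a|[[a k]|j]] [b|[[b l]|j']] //= [] *; subst.
  + move=> g i j _ /negP[]; case: j => [[a [k|]]|j].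
    * by apply/codomP; exists (inr (inl (a, k))).
    * by apply/codomP; exists (inl a).
    * by apply/codomP; exists (inr (inr j)).
  + apply: orep_dsum.
      by apply: orep_tensor => //; exact: (orep_comp (@r_hom i1)).
    apply: (@orep_inj _ _ _ _ inr); last exact: (tower_rep t1).
      by move=> j k [].
    move=> g _ [a|k] /codomP[j ->]; last by rewrite codom_f.
    by rewrite R1J.
- move=> h [a|[[a k]|j]] [b|[[b l]|j']]; rewrite /mixed /RH /= /tensor /=;
    rewrite ?rho'_iota ?iotaK ?mulr0 ?mulr1 ?(tower_base t1) ?(tower_base0 t1)
      ?RH1J ?(tower_iota t1)//.
- move=> g [a|[[a k]|j]] [b|[[b l]|j']] //=.
  by rewrite !ltnS => h; apply: (tower_band t1).
- by move=> g [[a k]|j] [[b l]|j'] //=.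
Qed.

Lemma tower_step : exists (J : finType) (lev : J -> nat) RH Rr,
  tower (existT _ i1 x1 :: w) tau lev RH Rr.
Proof.
have [i ni|Rr [Rgood Ri1]] := @choice_at I _ good i1 mixed good_mixed.
  exists (dsum (fun g => tau (@r i g)) (@R1 i)); split=> //.
  - apply: orep_dsum; last exact: (tower_rep t1).
    exact: (orep_comp (@r_hom i)).
  - by move=> h [a|p] [b|q] //=; [rewrite iotaK|rewrite (tower_iota t1)].
  - move=> g [a|p] [b|q] //=; rewrite !ltnS => h.
    exact: (tower_band t1).
exists J, lev, RH, Rr; split=> //.
- by apply: orep_dsum => //; exact: (tower_repH t1).
- by move=> i; have [] := Rgood i.
- by move=> i; have [] := Rgood i.
- by move=> i g a b /= ni; have [_ _ -> //] := Rgood i.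
- by move=> i g a j /= ni; have [_ _ -> //] := Rgood i.
- by move=> i; have [] := Rgood i.
move=> v [a va]; have [k zk] := rho'_x1.
(* Since [r x1 = 1], the part of the image of [v] that rises to level 1 is [v] tensored with column
   [None] of [rho' x1]. *)
pose v1 (e : E1) : R := rho' x1 (Some e.2) None * v e.1.
(* After the first letter, ascending proceeds exactly as in the tail tower, one level higher. *)
pose shift (u : E1 + J1 -> R) (p : E + J) : R := if p is inr p then u p else 0.
have first_step : up (level lev) (Rr i1 x1) (ext0 v) = shift (ext0 v1).
  apply/funext => p; rewrite /up; case: p => [b|p] /=; first by rewrite big1.
  rewrite big_sumType /= [X in _ + X]big1 ?addr0; last by move=> c _; rewrite mulr0.
  case: p => [[b l]|j] /=; last first.
    by apply: big1 => c; rewrite /lev /= eqSS; have := tower_lev t1 j; case: (lev1 j).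
  under eq_bigr => c _.
    rewrite Ri1 /mixed /= /tensor /= rx1; have [_ -> _ _] := tau_rep.
    rewrite -mulrA.
    over.
  by rewrite sum_delta.
have shift_up i (g : G i) u : up (level lev) (Rr i g) (shift u) =
    shift (up (level lev1) (R1 g) u).
  apply/funext => p; rewrite /up; case: p => [b|p] /=; first by rewrite big1.
  rewrite big_sumType /= big1 ?add0r; last by move=> c _; rewrite mulr0.
  apply: eq_big => q; first by rewrite /lev eqSS.
  rewrite /lev eqSS => /eqP pq; congr (_ * _).
  by have [_ _ _ _ ->] := Rgood i.
have shift_ascend w' u : ascend (level lev) Rr w' (shift u) =
    shift (ascend (level lev1) R1 w' u).
  by elim: w' u => [|l w' ih] u //=; rewrite shift_up ih.
have [|p [Lp pn0]] := tower_ascend t1 (v := v1).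
  by exists (a, k); rewrite /v1 /= mulf_neq0.
exists (inr p); split; first by rewrite /= /lev Lp.
by rewrite /= first_step shift_ascend.
Qed.

End TowerStep.

(** The base varies in the induction, because the tail tower is built over the tensor product of
    [tau] with [rho] restricted to [H]. *)
Lemma tower_exists (w : seq letter) : reduced w ->
  forall (E : finType) (tau : H -> E -> E -> R), orep tau ->
  exists (J : finType) (lev : J -> nat) RH Rr, tower w tau lev RH Rr.
Proof.
elim: w => [_ E tau|[i x] w ih]; first exact: tower_nil.
move=> [/= rx x1 iw rw] E tau otau.
have [||n [rho [u [orho rhoH rhox]]]] :=
  @separating_orep R _ _ _ _ x (@iota_hom i) (@r_hom i) (@iotaK i).
- exact: rx.
- exact/eqP.
have [rho' [orho' rho'H rho'x]] := householder_mix u orho.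
have osig : orep (fun h => rho (iota i h)) by exact: orep_comp.
have [J1 [lev1 [RH1 [R1 t1]]]] := ih rw _ _ (orep_tensor otau osig).
apply: (tower_step otau orho' _ rx iw (rho'x _ rhox) t1).
by move=> h; apply: rho'H => k; exact: rhoH.
Qed.

End Towers.

(** * The orthogonal group *)

Lemma initial_topology_cont (T U : topologicalType) (S : choiceType) (g : S -> U)
    (f : T -> initial_topology g) :
  continuous (fun x => g (f x)) -> continuous f.
Proof.
move=> cf; apply/continuousP => A [B oB <-].
by have /continuousP /(_ B oB) := cf.
Qed.

Lemma ptws_cont (I : eqType) (T U : topologicalType) (f : T -> {ptws I -> U}) :
  (forall i, continuous (fun x => f x i)) -> continuous f.
Proof.
move=> cf x; apply/cvg_sup => i; move: x.
apply/(@continuousP _ (initial_topology (@^~ i))) => A [B oB <-].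
by have /continuousP /(_ B oB) := cf i.
Qed.

Lemma ptws_proj_cont (I : eqType) (U : topologicalType) (i : I) :
  continuous (fun f : {ptws I -> U} => f i).
Proof. exact: (@proj_continuous I (fun=> U) i). Qed.

Section OrthogonalGroup.
Variables (R : realType) (J : finType).

(** The pointwise topology makes Tychonoff's theorem available. *)
Definition kernel_matrix := {ptws J * J -> R}.

Definition is_orthogonal (M : kernel_matrix) :=
  (forall i k, \sum_j M (i, j) * M (k, j) = (i == k)%:R) /\
  (forall i k, \sum_j M (j, i) * M (j, k) = (i == k)%:R).

Definition orthogonal : Type := {M : kernel_matrix | `[< is_orthogonal M >]}.

HB.instance Definition _ := SubChoice.on orthogonal.

Definition orth_val (M : orthogonal) : kernel_matrix := val M.

HB.instance Definition _ := Topological.copy orthogonal (initial_topology orth_val).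

Lemma orth_val_cont : continuous orth_val.
Proof. exact: initial_continuous. Qed.

Lemma orth_entry_cont i j : continuous (fun M : orthogonal => orth_val M (i, j)).
Proof. exact: (comp_cont orth_val_cont (@ptws_proj_cont _ _ (i, j))). Qed.

Lemma orthogonal_cont (T : topologicalType) (f : T -> orthogonal) :
  (forall i j, continuous (fun x => orth_val (f x) (i, j))) -> continuous f.
Proof.
by move=> cf; apply: initial_topology_cont; apply: ptws_cont => -[i j].
Qed.

Lemma orth_inj (M N : orthogonal) :
  (forall i j, orth_val M (i, j) = orth_val N (i, j)) -> M = N.
Proof. by move=> MN; apply/val_inj/funext => -[i j]; exact: MN. Qed.

Lemma orthP (M : orthogonal) : is_orthogonal (orth_val M).
Proof. by have /asboolP := valP M. Qed.

Definition mk_orth (M : kernel_matrix) (h : is_orthogonal M) : orthogonal :=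
  exist _ M (asboolT h).

Fact one_subproof : is_orthogonal (fun p => (p.1 == p.2)%:R).
Proof.
split=> i k /=; first by rewrite sum_delta eq_sym.
by under eq_bigr do rewrite eq_sym; rewrite sum_delta.
Qed.

Definition orth_one : orthogonal := mk_orth one_subproof.

Fact inv_subproof (M : orthogonal) :
  is_orthogonal (fun p => orth_val M (p.2, p.1)).
Proof. by have [h1 h2] := orthP M; split=> i k /=; [exact: h2|exact: h1]. Qed.

Definition orth_inv (M : orthogonal) : orthogonal := mk_orth (inv_subproof M).

Fact mul_subproof (M N : orthogonal) :
  is_orthogonal (fun p => \sum_j orth_val M (p.1, j) * orth_val N (j, p.2)).
Proof.
have [M1 M2] := orthP M; have [N1 N2] := orthP N.
have swap (F : J -> J -> J -> R) :
    \sum_j \sum_a \sum_b F j a b = \sum_a \sum_b \sum_j F j a b.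
  by rewrite exchange_big; apply: eq_bigr => a _; rewrite exchange_big.
split=> i k /=; under eq_bigr do rewrite big_distrlr /=; rewrite swap.
  transitivity (\sum_a \sum_b orth_val M (i, a) * orth_val M (k, b) * (a == b)%:R).
    apply: eq_bigr => a _; apply: eq_bigr => b _; rewrite -N1 mulr_sumr.
    by apply: eq_bigr => j _; ring.
  rewrite -M1; apply: eq_bigr => a _.
  by under eq_bigr do rewrite mulrC; rewrite sum_delta.
transitivity (\sum_a \sum_b orth_val N (a, i) * orth_val N (b, k) * (a == b)%:R).
  apply: eq_bigr => a _; apply: eq_bigr => b _; rewrite -M2 mulr_sumr.
  by apply: eq_bigr => j _; ring.
rewrite -N2; apply: eq_bigr => a _.
by under eq_bigr do rewrite mulrC; rewrite sum_delta.
Qed.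

Definition orth_mul (M N : orthogonal) : orthogonal := mk_orth (mul_subproof M N).

Lemma orth_mulE M N i k : orth_val (orth_mul M N) (i, k) =
  \sum_j orth_val M (i, j) * orth_val N (j, k).
Proof. by []. Qed.

Fact orth_mulA : associative orth_mul.
Proof.
move=> M N P; apply: orth_inj => i l; rewrite !orth_mulE.
under eq_bigr do rewrite orth_mulE mulr_sumr.
rewrite exchange_big; apply: eq_bigr => k _; rewrite orth_mulE mulr_suml.
by apply: eq_bigr => j _; rewrite mulrA.
Qed.

Fact orth_mul1 : left_id orth_one orth_mul.
Proof. by move=> M; apply: orth_inj => i k; rewrite orth_mulE sum_delta. Qed.

Fact orth_mulr1 : right_id orth_one orth_mul.
Proof. by move=> M; apply: orth_inj => i k; rewrite orth_mulE sum_deltar. Qed.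

Fact orth_mulV : left_inverse orth_one orth_inv orth_mul.
Proof. by move=> M; apply: orth_inj => i k; rewrite orth_mulE; exact: (orthP M).2. Qed.

Fact orth_mulrV : right_inverse orth_one orth_inv orth_mul.
Proof. by move=> M; apply: orth_inj => i k; rewrite orth_mulE; exact: (orthP M).1. Qed.

HB.instance Definition _ := isGroup.Build orthogonal
  orth_mulA orth_mul1 orth_mulr1 orth_mulV orth_mulrV.

Lemma orth_mulg_continuous : continuous (fun x : orthogonal * orthogonal => (x.1 * x.2)%g).
Proof.
apply: orthogonal_cont => i k.
apply: (@sum_cont R (orthogonal * orthogonal)%type J _ xpredT) => j.
apply: mulr_cont.
  exact: (comp_cont (@fst_cont _ _) (@orth_entry_cont i j)).
exact: (comp_cont (@snd_cont _ _) (@orth_entry_cont j k)).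
Qed.

Lemma orth_invg_continuous : continuous (fun x : orthogonal => (x^-1)%g).
Proof. by apply: orthogonal_cont => i k; exact: (@orth_entry_cont k i). Qed.

HB.instance Definition _ := isTopologicalGroup.Build orthogonal
  orth_mulg_continuous orth_invg_continuous.

Lemma orth_hausdorff : hausdorff_space orthogonal.
Proof.
move=> M N MN; apply/val_inj.
apply: (@hausdorff_product _ (fun _ : J * J => R) (fun _ => @Rhausdorff R)).
move=> A B nA nB.
have [P [AP BP]] := MN _ _ (orth_val_cont nA) (orth_val_cont nB).
by exists (val P).
Qed.

Lemma is_orthogonal_closed : closed (is_orthogonal : set kernel_matrix).
Proof.
have cc (f : kernel_matrix -> R) (c : R) : continuous f -> closed [set M | f M = c].
  by move=> cf; exact: (closed_comp (fun x _ => cf x) (@closed_eq _ c)).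
have ce i j : continuous (fun M : kernel_matrix => M (i, j)).
  exact: (@ptws_proj_cont _ _ (i, j)).
have -> : is_orthogonal =
   (\bigcap_(p in [set: J * J])
      [set M : kernel_matrix | \sum_j M (p.1, j) * M (p.2, j) = (p.1 == p.2)%:R]) `&`
   (\bigcap_(p in [set: J * J])
      [set M : kernel_matrix | \sum_j M (j, p.1) * M (j, p.2) = (p.1 == p.2)%:R]).
  apply/seteqP; split=> [M [h1 h2]|M [h1 h2]].
    by split=> -[i k] _; [exact: h1|exact: h2].
  by split=> i k; [exact: (h1 (i, k))|exact: (h2 (i, k))].
apply: closedI; apply: closed_bigI => -[i k] _; apply: cc; apply: sum_cont => j;
  by apply: mulr_cont.
Qed.

(** Rows are unit vectors, so all entries lie in [[-1, 1]], and a closed subset of a product of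
    segments is compact. *)
Lemma is_orthogonal_compact : compact (is_orthogonal : set kernel_matrix).
Proof.
apply: (@subclosed_compact kernel_matrix _
    [set f : kernel_matrix | forall p, `[(-1 : R), 1]%classic (f p)]).
- exact: is_orthogonal_closed.
- apply: (@tychonoff _ (fun _ : J * J => R) (fun=> `[(-1 : R), 1]%classic)) => _.
  exact: segment_compact.
move=> M [h _] [i j]; have := h i i; rewrite eqxx (bigD1 j)//= => Mij.
have : M (i, j) * M (i, j) <= 1.
  by rewrite -[leRHS]Mij lerDl sumr_ge0// => k _; rewrite -expr2 sqr_ge0.
by rewrite /= in_itv/=; nra.
Qed.

(** The topology is initial, so a cluster point of the image filter among orthogonal matrices
    lifts. *)
Lemma orth_compact : compact [set: orthogonal].
Proof.
move=> F FF _.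
have [|M [oM clM]] := is_orthogonal_compact (fmap_proper_filter orth_val FF).
  by apply: (@filterS _ F _ setT) => [N _|]; [exact: orthP|exact: filterT].
exists (mk_orth oM); split=> // A B FA [_ [[C oC <-] CM] CB].
have [_ [[N AN <-] CN]] : orth_val @` A `&` C !=set0.
  apply: clM; last by apply: open_nbhs_nbhs.
  by apply: (@filterS _ F _ A) => // N AN; exists N.
by exists N; split=> //; exact: CB.
Qed.

HB.instance Definition _ := isCompactHausdorff.Build orthogonal
  orth_hausdorff orth_compact.

Fact orep_orthogonal (G : compactGroupType) (rho : G -> J -> J -> R) (g : G) :
  orep rho -> is_orthogonal (fun p => rho g p.1 p.2).
Proof.
move=> [_ r1 rM rV]; split=> i k /=.
  by under eq_bigr do rewrite -(rV g _ k); rewrite -rM mulgV r1.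
by under eq_bigr do rewrite -(rV g i); rewrite -rM mulVg r1.
Qed.

Definition orth_of (G : compactGroupType) (rho : G -> J -> J -> R)
  (orho : orep rho) (g : G) : orthogonal := mk_orth (orep_orthogonal g orho).

Lemma orth_of_hom (G : compactGroupType) (rho : G -> J -> J -> R) (orho : orep rho) :
  compact_hom (orth_of orho).
Proof.
have [c r1 rM rV] := orho; split; last by apply: orthogonal_cont => i j; exact: c.
split; first by apply: orth_inj => i j; exact: r1.
by move=> g h; apply: orth_inj => i j; exact: rM.
Qed.

End OrthogonalGroup.

(** * Normal forms in the amalgam *)

Section Subgroup.
Variable A : groupType.

Definition is_subgroup (P : A -> Prop) :=
  [/\ P 1%g, forall x y, P x -> P y -> P (x * y)%g & forall x, P x -> P x^-1%g].

(** The proof [hP] is a parameter of the type, so that a group structure can be declared on the type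
    itself. *)
Definition subgroup_of (P : A -> Prop) (hP : is_subgroup P) : Type :=
  {b : A | `[< P b >]}.

Variables (P : A -> Prop) (hP : is_subgroup P).

Local Notation S := (subgroup_of hP).

Definition subg_val (x : S) : A := sval x.

Definition mk_subg (b : A) (Pb : P b) : S := exist _ b (asboolT Pb).

Lemma subg_valP (x : S) : P (subg_val x).
Proof. exact: (asboolW (proj2_sig x)). Qed.

Lemma subg_val_inj : injective subg_val.
Proof. by move=> [x Px] [y Py] /= xy; apply: eq_exist. Qed.

Definition subg_one : S := let: And3 h _ _ := hP in mk_subg h.
Definition subg_mul (x y : S) : S :=
  let: And3 _ h _ := hP in mk_subg (h _ _ (subg_valP x) (subg_valP y)).
Definition subg_inv (x : S) : S :=
  let: And3 _ _ h := hP in mk_subg (h _ (subg_valP x)).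

Lemma subg_oneE : subg_val subg_one = 1%g.
Proof. by rewrite /subg_one; case: hP. Qed.

Lemma subg_mulE x y : subg_val (subg_mul x y) = (subg_val x * subg_val y)%g.
Proof. by rewrite /subg_mul; case: hP. Qed.

Lemma subg_invE x : subg_val (subg_inv x) = (subg_val x)^-1%g.
Proof. by rewrite /subg_inv; case: hP. Qed.

Fact subg_mulA : associative subg_mul.
Proof. by move=> x y z; apply: subg_val_inj; rewrite !subg_mulE mulgA. Qed.

Fact subg_mul1 : left_id subg_one subg_mul.
Proof. by move=> x; apply: subg_val_inj; rewrite subg_mulE subg_oneE mul1g. Qed.

Fact subg_mulr1 : right_id subg_one subg_mul.
Proof. by move=> x; apply: subg_val_inj; rewrite subg_mulE subg_oneE mulg1. Qed.

Fact subg_mulV : left_inverse subg_one subg_inv subg_mul.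
Proof.
by move=> x; apply: subg_val_inj; rewrite subg_mulE subg_invE subg_oneE mulVg.
Qed.

Fact subg_mulrV : right_inverse subg_one subg_inv subg_mul.
Proof.
by move=> x; apply: subg_val_inj; rewrite subg_mulE subg_invE subg_oneE mulgV.
Qed.

HB.instance Definition _ := Choice.on S.
HB.instance Definition _ := isGroup.Build S
  subg_mulA subg_mul1 subg_mulr1 subg_mulV subg_mulrV.

End Subgroup.

Section Amalgam.
Variables (I : Type) (H : groupType) (G : I -> groupType).
Variable iota : forall i, H -> G i.
Variables (A : groupType) (a0 : H -> A) (a : forall i, G i -> A).
Hypothesis colim : group_colimit iota a0 a.

(** The universal map to the subgroup, followed by its inclusion, is an endomorphism of [A]
    compatible with the legs; by uniqueness it is the identity. *)
Lemma colimit_generated (P : A -> Prop) : is_subgroup P ->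
  (forall h, P (a0 h)) -> (forall i (g : G i), P (a g)) -> forall b, P b.
Proof.
move=> hP P0 Pa b; have [[a0M aM ai] univ] := colim.
pose h (x : H) : subgroup_of hP := mk_subg hP (P0 x).
pose g i (x : G i) : subgroup_of hP := mk_subg hP (@Pa i x).
have [|f [[fM fh fg] _]] := univ (subgroup_of hP) h g.
  split.
  - split=> [|x y]; apply: subg_val_inj; rewrite ?subg_oneE ?subg_mulE /= a0M//.
  - move=> i; split=> [|x y]; apply: subg_val_inj;
      rewrite ?subg_oneE ?subg_mulE /= (aM i)//.
  - by move=> i x; apply: subg_val_inj; exact: (ai i x).
have [|k [_ kuniq]] := univ A a0 a; first by split.
have e1 : k = (fun x => subg_val (f x)).
  apply: kuniq; split.
  - split=> [|x y]; first by rewrite fM subg_oneE.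
    by rewrite fM subg_mulE.
  - by move=> x /=; have /= -> := fh x.
  - by move=> i x /=; have /= -> := fg i x.
have e2 : k = id by apply: kuniq; split.
have -> : b = subg_val (f b) by rewrite -[LHS]/(id b) -e2 e1.
exact: subg_valP.
Qed.

End Amalgam.

Section NormalForm.
Variables (I : Type) (H : compactGroupType) (G : I -> compactGroupType).
Variables (iota : forall i, H -> G i) (r : forall i, G i -> H).
Hypotheses (iota_hom : forall i, compact_hom (iota i)).
Hypotheses (r_hom : forall i, compact_hom (@r i)).
Hypothesis (iotaK : forall i, cancel (iota i) (@r i)).
Variables (A : groupType) (a0 : H -> A) (a : forall i, G i -> A).
Hypothesis colim : @group_colimit I H G iota A a0 a.

Definition word_prod (w : seq {i : I & G i}) (b : A) : A :=
  foldl (fun b l => a (tagged l) * b)%g b w.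

Lemma word_prodM w b b' : word_prod w (b * b')%g = (word_prod w b * b')%g.
Proof. by elim: w b => [//|l w ih] b /=; rewrite mulgA ih. Qed.

Definition normal_form (b : A) :=
  exists w h, reduced r w /\ b = word_prod w (a0 h).

Lemma normal_formM0 b k : normal_form b -> normal_form (b * a0 k)%g.
Proof.
have [[a0M _ _] _] := colim.
move=> [w [h [rw ->]]]; exists w, (h * k)%g; split=> //.
by rewrite -word_prodM a0M.
Qed.

(** A factor on the right meets the head of the word: its part in the kernel of the retraction
    either merges with a head of the same index or becomes a new head. *)
Lemma normal_formMa b i (g : G i) : normal_form b -> normal_form (b * a g)%g.
Proof.
have [[a0M aM ai] _] := colim; have [r1 rM] := (@r_hom i).1.
move=> [w [h [rw ->]]].
(* [x] is the component of [g'] in the kernel of [r i]; the remaining factor from [H] is absorbed by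
   [normal_formM0]. *)
pose g' := (iota i h * g)%g; pose x := (g' * (iota i (r g'))^-1)%g.
have rx : r x = 1%g.
  by rewrite /x rM (compact_homV (@r_hom i)) iotaK mulgV.
have -> : (word_prod w (a0 h) * a g = word_prod w (a x) * a0 (r g'))%g.
  rewrite -!word_prodM -(ai i h) -(ai i (r g')) /= -!aM.
  by rewrite /x mulgVK.
apply: normal_formM0; have a01 := a0M.1.
have nf_cons (y : G i) w' : r y = 1%g -> avoids i w' -> reduced r w' ->
    normal_form (word_prod w' (a y)).
  move=> ry iw' rw'; have [->|y1] := pselect (y = 1%g).
    by exists w', 1%g; split=> //; rewrite a01; congr word_prod; exact: (aM i).1.
  exists (existT _ i y :: w'), 1%g; split; first by split.
  by rewrite /= a01 mulg1.
case: w rw => [|[j y] w] rw; first exact: nf_cons.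
have [ij|ij] := pselect (i = j); last exact: nf_cons.
case: j / ij y rw => y [/= ry _ iw rw].
(* The merged letter may be trivial; [nf_cons] then drops it, leaving the reduced tail. *)
rewrite -(aM i); apply: nf_cons => //.
by rewrite rM ry rx mulg1.
Qed.

(** The elements which, along with their inverses, preserve normal forms by right multiplication
    form a subgroup containing the generators. *)
Lemma normal_formP b : normal_form b.
Proof.
have [[a0M aM ai] _] := colim.
have aV i g : (a (g : G i))^-1%g = a g^-1%g.
  by apply: mulg1_eq; rewrite -(aM i).2 mulgV (aM i).1.
have a0V h : (a0 h)^-1%g = a0 h^-1%g.
  by apply: mulg1_eq; rewrite -a0M.2 mulgV a0M.1.
suff : forall c, normal_form c -> normal_form (c * b)%g /\ normal_form (c * b^-1)%g.
  move=> /(_ 1%g) []; last by rewrite mul1g.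
  by exists [::], 1%g; rewrite /= a0M.
move: b; apply: (colimit_generated colim) => [|h c nc|i g c nc].
- split=> [c nc|x y hx hy c nc|x hx c nc].
  + by rewrite invg1 mulg1.
  + rewrite invgM !mulgA; split.
      by apply: (hy _ _).1; apply: (hx _ _).1.
    by apply: (hx _ _).2; apply: (hy _ _).2.
  + by rewrite invgK; have [] := hx c nc.
- by rewrite a0V; split; exact: normal_formM0.
- by rewrite aV; split; exact: normal_formMa.
Qed.

End NormalForm.

(** * Injectivity of the comparison homomorphism *)

Theorem theorem2p45 (I : Type) (H : compactGroupType)
    (G : I -> compactGroupType) (iota : forall i : I, H -> G i)
    (iota_split : forall i : I, split_embedding (iota i)) :
  algebraically_sound iota.
Proof.
have iota_hom i : compact_hom (iota i) by have [[]] := iota_split i.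
have exr i : exists r : G i -> H, compact_hom r /\ cancel (iota i) r.
  by have [_ [r hr ri]] := iota_split i; exists r.
pose r i := projT1 (cid (exr i)).
have r_hom i : compact_hom (r i) by case: (projT2 (cid (exr i))).
have iotaK i : cancel (iota i) (r i) by case: (projT2 (cid (exr i))).
move=> A a0 a C c0 c colimA colimC phi phiM phi0 phia.
have [[a0M aM _] _] := colimA; have [[c0M cM ci] univ] := colimC.
suff ker b : phi b = 1%g -> b = 1%g.
  move=> u v uv; apply/divg1_eq/ker.
  have := phiM.2 (u / v)%g v; rewrite mulgVK uv.
  by move=> e; apply: (mulIg (phi v)); rewrite -e mul1g.
have [w [h [rw ->]]] := normal_formP r_hom iotaK colimA b.
case: w rw => [_ /= phib|l w0].
  (* The retractions form a cocone to [H] with leg [id], so an empty word in the kernel has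
     [h = 1]. *)
  have [|f [[[[f1 _] _] f0 _] _]] := univ H id r.
    by split=> //; split=> [//|x]; exact: cvg_id.
  have := f0 h; rewrite /= -(phi0 h) /= phib f1 => <-.
  exact: a0M.1.
set w := l :: w0 => rw phib; exfalso.
pose R : realType := Rdefinitions.R.
(* Level 0 of the tower is a single trivial line. *)
have otau : orep (fun (_ : H) (i j : unit) => (i == j)%:R : R).
  exact: orep_trivial.
have [J [lev [RH [Rr tw]]]] := tower_exists iota_hom r_hom iotaK rw otau.
pose oH := orth_of (tower_repH tw).
pose oG i := orth_of (tower_rep tw i).
(* The tower representations agree on [H], hence form a compact cocone to an orthogonal group. *)
have [|f [[[fM _] f0 fc] _]] := univ (orthogonal R (unit + J)%type) oH oG.
  split=> [|i|i x]; [exact: orth_of_hom|exact: orth_of_hom|].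
  by apply: orth_inj => p q; exact: (tower_iota tw).
pose v0 : unit + J -> R := ext0 (fun=> 1).
have act w' b' v p : (forall p, \sum_q orth_val (f (phi b')) (p, q) * v0 q = v p) ->
    \sum_q orth_val (f (phi (word_prod a w' b'))) (p, q) * v0 q =
    word_act Rr w' v p.
  elim: w' b' v p => [|l' w' ih] b' v p b'v //=.
  apply: ih => {}p; rewrite phiM.2 fM.2.
  have -> : f (phi (a (tag l') (tagged l'))) = oG (tag l') (tagged l').
    by rewrite -(fc (tag l') (tagged l')) /= -phia.
  transitivity (\sum_q (\sum_k Rr (tag l') (tagged l') p k *
      orth_val (f (phi b')) (k, q)) * v0 q); first exact: eq_bigr.
  under [LHS]eq_bigr do rewrite mulr_suml.
  rewrite exchange_big; apply: eq_bigr => k _ /=.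
  under eq_bigr do rewrite -mulrA.
  by rewrite -mulr_sumr b'v.
have act0 p : \sum_q orth_val (f (phi (a0 h))) (p, q) * v0 q = v0 p.
  have -> : f (phi (a0 h)) = oH h by rewrite -(f0 h) /= -phi0.
  rewrite big_sumType /= [X in _ + X]big1 ?addr0; last first.
    by move=> j _; rewrite mulr0.
  rewrite (bigD1 tt)//= big1 ?addr0; last by case.
  rewrite mulr1; case: p => [[]|j]; first exact: (tower_base tw).
  apply: (orep_sym0 (tower_repH tw)) => h'.
  exact: (tower_base0 tw).
have [|p [Lp]] := tower_ascend tw (v := fun=> 1); first by exists tt; rewrite oner_eq0.
rewrite -(word_act_ascend (tower_band tw) (n := 0) (u := v0))//; last 1 first.
- by move=> [].
(* As [phi] kills the element, the word fixes [v0], whose entries above level 0 vanish; but [p] lies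
   at the positive level [size w], where the ascending product is nonzero. *)
rewrite -(act w _ v0 p act0) phib fM.1 (_ : \sum_q _ = v0 p); last exact: (sum_delta p v0).
by case: p Lp => // j _; rewrite eqxx.
Qed.
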